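(* Fix $p\ge1$ and assume one of the following: (1) $(X_{it})$ is an iid field of regularly varying random variables with index $\alpha\in(0,4)$, and $\mathbb E[X]=0$ if $\mathbb E|X|<\infty$; (2) $(X_{it})$ is the stochastic volatility model $X_{it}=\sigma_{it}Z_{it}$ satisfying the hypotheses (1)–(3) below, and $\mathbb E[Z]=0$ if $\mathbb E|Z|<\infty$: (i) $Z$ is regularly varying with index $\alpha\in(0,4)\setminus\{2\}$; (ii) $((\sigma_{1t},\dots,\sigma_{pt}))_{t\ge1}$ is strongly mixing with rate $(\alpha_h)$, $\sum_h\alpha_h^{\delta/(2+\delta)}<\infty$ for some $\delta>0$; (iii) $\mathbb E[\sigma^{2\max(2+\delta,\alpha+\epsilon)}]<\infty$ for some $\epsilon>0$. Then $$a_n^{-2}\big\|\mathbf X^n(\mathbf X^n)'-\operatorname{diag}(\mathbf X^n(\mathbf X^n)')\big\|_2\xrightarrow{\mathbb P}0,$$ where $\|\cdot\|_2$ is the spectral norm, $\operatorname{diag}(\mathbf A)$ is the diagonal matrix with the diagonal of $\mathbf A$, and $(a_n)$ satisfies $n\,\mathbb P(|X|>a_n)\to1$.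
   Context: Stochastic volatility model: $X_{it}=\sigma_{it}Z_{it}$, with $(Z_{it})$ an iid field independent of a strictly stationary ergodic field $(\sigma_{it})$ of non-negative random variables; $Z,\sigma,X$ generic elements. A real random variable $W$ is regularly varying with index $\alpha$ if $\mathbb P(W>x)\sim p_+L(x)x^{-\alpha}$, $\mathbb P(W<-x)\sim p_-L(x)x^{-\alpha}$, $p_++p_-=1$, $L$ slowly varying. $\mathbf X^n=(X_{it})_{1\le i\le p,\,1\le t\le n}\in\mathbb R^{p\times n}$, so $\mathbf X^n(\mathbf X^n)'=(S_{ij})$ with $S_{ij}=\sum_{t=1}^nX_{it}X_{jt}$. *)

(* Defs.v *)
From HB Require Import structures.
From mathcomp Require Import all_boot all_order all_algebra.
From mathcomp Require Import all_classical all_reals all_analysis.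
Set Implicit Arguments. Unset Strict Implicit. Unset Printing Implicit Defensive.
Import Order.TTheory GRing.Theory Num.Theory.
Import numFieldNormedType.Exports.
Local Open Scope classical_set_scope.
Local Open Scope ring_scope.

Section Defs.
Context {R : realType} {d : measure_display} {T : measurableType d}.
Variable P : probability T R.

Definition Pr (A : set T) : R := fine (P A).

Definition slowly_varying (L : R -> R) : Prop :=
  (\forall x \near +oo, 0 < L x) /\
  forall c : R, 0 < c -> (fun x => L (c * x) / L x) @ +oo --> (1 : R).

Definition regularly_varying (W : T -> R) (alpha : R) : Prop :=
  exists (pp pm : R) (L : R -> R),
    [/\ 0 <= pp /\ 0 <= pm, pp + pm = 1, slowly_varying L,
     ((fun x => Pr [set w | x < W w] / (L x * x `^ (- alpha))) @ +oo --> pp) &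
     ((fun x => Pr [set w | W w < - x] / (L x * x `^ (- alpha))) @ +oo --> pm)].

Definition mutually_independent {I : eqType} (Y : I -> T -> R) : Prop :=
  forall (s : seq I) (B : I -> set R), uniq s ->
    (forall k, measurable (B k)) ->
    P (\bigcap_(k in [set` s]) (Y k @^-1` B k)) = (\prod_(k <- s) P (Y k @^-1` B k))%E.

Definition identically_distributed {I : Type} (Y : I -> T -> R) : Prop :=
  forall (k l : I) (B : set R), measurable B -> P (Y k @^-1` B) = P (Y l @^-1` B).

Definition iid {I : eqType} (Y : I -> T -> R) : Prop :=
  (forall k, measurable_fun setT (Y k)) /\
  mutually_independent Y /\ identically_distributed Y.

Definition gen_sigma {I : Type} (Y : I -> T -> R) (J : set I) : set (set T) :=
  <<s [set Y k @^-1` B | k in J & B in [set B : set R | measurable B]] >>.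

Definition independent_families {I J : Type} (Y : I -> T -> R) (V : J -> T -> R) : Prop :=
  forall A B, gen_sigma Y setT A -> gen_sigma V setT B ->
    P (A `&` B) = (P A * P B)%E.

Definition shift2 (h k : nat * nat) : nat * nat := (k.1 + h.1, k.2 + h.2)%N.

Definition strictly_stationary (Y : nat * nat -> T -> R) : Prop :=
  forall (h : nat * nat) (s : seq (nat * nat)) (B : nat * nat -> set R),
    (forall k, measurable (B k)) ->
    P (\bigcap_(k in [set` s]) (Y k @^-1` B k)) =
    P (\bigcap_(k in [set` s]) (Y (shift2 h k) @^-1` B k)).

Definition cyl_sigma : set (set (nat * nat -> R)) :=
  <<s [set [set f : nat * nat -> R | B (f k)] | k in setT & B in [set B : set R | measurable B]] >>.

Definition ergodic_field (Y : nat * nat -> T -> R) : Prop :=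
  forall E : set (nat * nat -> R), cyl_sigma E ->
    (forall h : nat * nat, [set f : nat * nat -> R | E (f \o shift2 h)] = E) ->
    let A := [set w | E (fun k => Y k w)] in P A = 0%E \/ P A = 1%E.

Definition strongly_mixing_rate (p : nat) (Y : nat -> nat -> T -> R)
    (alpha : nat -> R) : Prop :=
  forall (t h : nat) (A B : set T),
    gen_sigma (fun k : nat * nat => Y k.1 k.2)
              [set k | (k.1 < p)%N /\ (k.2 <= t)%N] A ->
    gen_sigma (fun k : nat * nat => Y k.1 k.2)
              [set k | (k.1 < p)%N /\ (t + h <= k.2)%N] B ->
    `| Pr (A `&` B) - Pr A * Pr B | <= alpha h.

Definition spec_norm (p : nat) (M : 'M[R]_p) : R :=
  sup [set Num.sqrt (\sum_(i < p) ((M *m v) i ord0) ^+ 2) |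
       v in [set v : 'cV[R]_p | \sum_(i < p) (v i ord0) ^+ 2 = 1]].

Definition XXt (p n : nat) (X : nat -> nat -> T -> R) (w : T) : 'M[R]_p :=
  \matrix_(i < p, j < p) \sum_(t < n) X i t w * X j t w.

Definition diag_part (p : nat) (M : 'M[R]_p) : 'M[R]_p :=
  diag_mx (\row_(i < p) M i i).

Definition cvg_in_prob (Y : nat -> T -> R) (l : R) : Prop :=
  forall e : R, 0 < e -> (fun n => Pr [set w | e < `| Y n w - l |]) @ \oo --> (0 : R).

End Defs.

(* Main.v *)
(* The spectral norm of the off-diagonal part is at most the sum of the moduli of
   its entries, so it suffices that S_ij / a_n^2 tends to 0 in probability for
   i <> j.  The iid case is the volatility model with sigma = 1, and only
   E sigma^4 < oo is needed from sigma.  By regular variation n a_n^(-g) -> 0 for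
   all g > alpha, because x^g P(|X| > x) -> oo, and E|Z|^b < oo for b < alpha.
   For alpha < 2, take b <= 1 with b < alpha < 2b: subadditivity of x^b gives
   E|S_ij|^b = O(n), while the threshold raised to the power b is of order
   a_n^(2b).  For alpha >= 2, Z is centred; truncating it at a_n^2, write
   Z = A + B with A, B centred and Z Z' = A A' + A B' + B Z'.  The products A A' are
   orthogonal and are handled by Chebyshev's inequality, the others by Markov's
   inequality. *)
Require Import Defs.
From HB Require Import structures.
From mathcomp Require Import all_boot all_order all_algebra.
From mathcomp Require Import all_classical all_reals all_analysis.
From mathcomp Require Import measurable_realfun ring lra.
Import Order.TTheory GRing.Theory Num.Theory.
Import numFieldNormedType.Exports.
Local Open Scope classical_set_scope.
Local Open Scope ring_scope.

(** * Independence and expectations of products *)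

(** The independence hypotheses are stated on events: product formulas on rectangles for [Z], and on
    two generated sigma-algebras for [Z] against [sigma]. The moment bounds need them for
    expectations of a random weight times functions of up to four noise variables. The property
    [factors] bridges the gap: the weight is tested jointly with cylinder events, and noise
    variables are absorbed one at a time. It handles non-negative functions; bounded signed ones are
    reached by adding a bound. The truncation level comes from two competing errors. At level c,
    with moment exponent b <= 2, the orthogonal part costs n c^(4 - 2b) / a_n^4 and the remainder n
    c^(1 - b) / a_n^2. For c = a_n the latter is n a_n^(-1 - b), where 1 + b <= 3 is too small an
    exponent if alpha >= 3. For c = a_n^2 the exponents are 4b - 4 and 2b, and some b < alpha puts
    both above alpha. *)

Lemma measurable_preimageT (R : realType) (d : measure_display)
    (T : measurableType d) (Y : T -> R) (B : set R) :
  measurable_fun setT Y -> measurable B -> measurable (Y @^-1` B).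
Proof. by move=> mY mB; rewrite -[X in measurable X]setTI; exact: mY. Qed.

Section change_of_integrand.
Context (R : realType) (d : measure_display) (T : measurableType d).
Variable P : probability T R.

Import HBNNSimple.

(** The hypothesis says that the measures with densities [h1] and [h2] have the same image under
    [Y]. Linearity extends it from indicators to simple functions, and monotone convergence to all
    non-negative [g]. *)
Lemma ge0_integral_mul_comp_eq (h1 h2 Y : T -> R) (g : R -> R) :
  measurable_fun setT h1 -> measurable_fun setT h2 -> measurable_fun setT Y ->
  (forall w, 0 <= h1 w) -> (forall w, 0 <= h2 w) ->
  (forall B, measurable B -> \int[P]_w (h1 w * \1_(Y @^-1` B) w)%:E =
                             \int[P]_w (h2 w * \1_(Y @^-1` B) w)%:E)%E ->
  measurable_fun setT g -> (forall x, 0 <= g x) ->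
  (\int[P]_w (h1 w * g (Y w))%:E = \int[P]_w (h2 w * g (Y w))%:E)%E.
Proof.
move=> mh1 mh2 mY h10 h20 heq mg g0.
have mgE : measurable_fun (setT : set R) (EFin \o g) by exact/measurable_EFinP.
pose u := nnsfun_approx measurableT mgE.
have ucvg y : EFin \o u^~ y @ \oo --> (g y)%:E.
  by apply: (@cvg_nnsfun_approx _ _ _ _ measurableT _ mgE) => // x _; rewrite lee_fin.
have mpre B : measurable B -> measurable (Y @^-1` B) by exact: measurable_preimageT.
have lim_simple (h : T -> R) : measurable_fun setT h -> (forall w, 0 <= h w) ->
  (\int[P]_w (h w * g (Y w))%:E =
   limn (fun n => \int[P]_w (h w * u n (Y w))%:E))%E.
  move=> mh h0.
  rewrite -monotone_convergence//.
  - apply: eq_integral => w _; apply/esym/cvg_lim => //=.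
    under eq_fun do rewrite EFinM.
    by rewrite EFinM; apply: cvgeZl => //; exact: ucvg.
  - move=> n; apply/measurable_EFinP/measurable_funM => //.
    exact: measurableT_comp.
  - by move=> n w _; rewrite lee_fin mulr_ge0.
  - move=> w _ m n mn; rewrite lee_fin ler_wpM2l//.
    exact/lefP/nd_nnsfun_approx.
have simpleE (h : T -> R) n : measurable_fun setT h -> (forall w, 0 <= h w) ->
  (\int[P]_w (h w * u n (Y w))%:E =
   \sum_(k \in range (u n)) k%:E *
     \int[P]_w (h w * \1_(Y @^-1` (u n @^-1` [set k])) w)%:E)%E.
  move=> mh h0.
  have mk k : measurable_fun setT
      (fun w => h w * \1_(Y @^-1` (u n @^-1` [set k])) w).
    by apply: measurable_funM => //; apply: measurable_indic; exact: mpre.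
  transitivity (\int[P]_w (\sum_(k \in range (u n))
      (k * (h w * \1_(Y @^-1` (u n @^-1` [set k])) w))%:E))%E.
    apply: eq_integral => w _; rewrite fsumEFin//; congr EFin.
    rewrite fimfunE mulrC.
    rewrite !fsbig_finite//= big_distrl/=; apply: eq_bigr => k _.
    by rewrite -mulrA; congr (_ * _); rewrite mulrC.
  have k0 k : (u n @^-1` [set k] != set0) -> 0 <= k.
    by move=> /set0P[x /= <-].
  have kterm0 k w : 0 <= k * (h w * \1_(Y @^-1` (u n @^-1` [set k])) w).
    (* A number outside the range of [u n] may be negative, but its term vanishes. *)
    have [->|/k0 ?] := eqVneq (u n @^-1` [set k]) set0.
      by rewrite preimage_set0 indic0/= !mulr0.
    by rewrite !mulr_ge0.
  rewrite ge0_integral_fsum//; last 2 first.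
  - by move=> k; apply/measurable_EFinP; exact: measurable_funM.
  - by move=> k w _; rewrite lee_fin.
  apply: eq_fsbigr => k; rewrite inE => -[x _ xk].
  under eq_integral do rewrite EFinM.
  rewrite ge0_integralZl//.
  - exact/measurable_EFinP.
  - by move=> w _; rewrite lee_fin mulr_ge0.
  - by rewrite lee_fin -xk.
rewrite !lim_simple//; congr (lim (_ @ \oo)); apply/funext => n.
rewrite !simpleE//; apply: eq_fsbigr => k _.
by rewrite heq.
Qed.

End change_of_integrand.

(** The family generating [gen_sigma Y setT], named so that [g_sigma_algebraType] can turn this
    sigma-algebra into a measurable type. *)
Definition generators {R : realType} {d : measure_display} {T : measurableType d}
    {I : Type} (Y : I -> T -> R) : set (set T) :=
  [set Y k @^-1` B | k in setT & B in [set B : set R | measurable B]].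

Section factorization.
Context (R : realType) (d : measure_display) (T : measurableType d).
Variable P : probability T R.
Context (I : eqType).
Implicit Types (Y : I -> T -> R) (s : seq I) (h : T -> R).

Definition cylinder Y s (B : I -> set R) : set T :=
  \bigcap_(k in [set` s]) (Y k @^-1` B k).

(* A form of joint independence of [h] and [(Y k)_(k in s)] tested on cylinder
   events only; it survives multiplication of [h] by a function of one [Y k],
   at the cost of removing [k] from [s]. *)
Definition factors Y s h := forall B : I -> set R, (forall k, measurable (B k)) ->
  (\int[P]_w (h w * \1_(cylinder Y s B) w)%:E =
   (\int[P]_w (h w)%:E) * \prod_(k <- s) P (Y k @^-1` B k))%E.

Lemma measurable_cylinder Y s B : (forall k, measurable_fun setT (Y k)) ->
  (forall k, measurable (B k)) -> measurable (cylinder Y s B).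
Proof.
move=> mY mB; apply: fin_bigcap_measurable => //= k _.
exact: measurable_preimageT.
Qed.

Lemma prode_ge0_fin s (F : I -> set T) : (forall k, measurable (F k)) ->
  (0 <= \prod_(k <- s) P (F k))%E /\ (\prod_(k <- s) P (F k))%E \is a fin_num.
Proof.
move=> mF; elim: s => [|k s [IH1 IH2]]; first by rewrite big_nil.
by rewrite big_cons mule_ge0// fin_numM// fin_num_measure.
Qed.

(** Fix a cylinder over [s] and let only the event of [Y k] vary. Then [factors] says that [h] times
    the indicator of the cylinder, and a constant [c], have the same integral over every event of
    [Y k]; [ge0_integral_mul_comp_eq] passes from these events to [g (Y k)]. The whole space as
    cylinder gives the first conclusion. *)
Lemma factors_mul Y k s h (g : R -> R) :
  (forall k, measurable_fun setT (Y k)) -> uniq (k :: s) ->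
  measurable_fun setT h -> (forall w, 0 <= h w) ->
  (\int[P]_w (h w)%:E < +oo)%E -> factors Y (k :: s) h ->
  measurable_fun setT g -> (forall x, 0 <= g x) ->
  (\int[P]_w (h w * g (Y k w))%:E =
     (\int[P]_w (h w)%:E) * \int[P]_w (g (Y k w))%:E)%E /\
  factors Y s (fun w => h w * g (Y k w)).
Proof.
move=> mY /= /andP[ks us] mh h0 hoo fh mg g0.
have mgY : measurable_fun setT (fun w => g (Y k w)) by exact: measurableT_comp.
have hfin : (\int[P]_w (h w)%:E)%E \is a fin_num.
  by rewrite ge0_fin_numE// integral_ge0// => w _; rewrite lee_fin.
have key B : (forall l, measurable (B l)) ->
    (\int[P]_w (h w * g (Y k w) * \1_(cylinder Y s B) w)%:E =
     (\int[P]_w (h w)%:E * \int[P]_w (g (Y k w))%:E) *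
       \prod_(l <- s) P (Y l @^-1` B l))%E.
  move=> mB.
  have [p0 pfin] := prode_ge0_fin s (fun l => Y l @^-1` B l)
                      (fun l => measurable_preimageT _ _ _ _ _ (mY l) (mB l)).
  set p := (\prod_(l <- s) _)%E in p0 pfin *.
  pose c := fine (\int[P]_w (h w)%:E * p)%E.
  have cE : c%:E = (\int[P]_w (h w)%:E * p)%E by rewrite fineK// fin_numM.
  have c0 : 0 <= c.
    by rewrite fine_ge0// mule_ge0// integral_ge0// => w _; rewrite lee_fin.
  transitivity (\int[P]_w (c * g (Y k w))%:E)%E; last first.
    under eq_integral do rewrite EFinM.
    rewrite ge0_integralZl//; last 2 first.
    - exact/measurable_EFinP.
    - by move=> w _; rewrite lee_fin.
    by rewrite cE muleAC.
  transitivity (\int[P]_w (h w * \1_(cylinder Y s B) w * g (Y k w))%:E)%E.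
    by apply: eq_integral => w _; rewrite mulrAC.
  have mc := measurable_cylinder _ s _ mY mB.
  apply: (ge0_integral_mul_comp_eq _ _ _ _ _ (cst c)) => //.
  - exact: measurable_funM.
  - by move=> w; rewrite mulr_ge0.
  move=> B0 mB0.
  (* Since [k] is not in [s], placing [B0] at [k] leaves the cylinder over [s] unchanged. *)
  pose B' l := if l == k then B0 else B l.
  have mB' l : measurable (B' l) by rewrite /B'; case: ifP.
  have sB' : cylinder Y s B' = cylinder Y s B.
    apply: eq_bigcapr => l /= ls; rewrite /B'; case: eqP => // lk.
    by rewrite lk in ls; rewrite ls in ks.
  have B'k : B' k = B0 by rewrite /B' eqxx.
  have := fh _ mB'; rewrite big_cons B'k.
  rewrite (_ : (\prod_(l <- s) P (Y l @^-1` B' l) = p)%E); last first.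
    rewrite /p; apply: eq_big_seq => l ls; rewrite /B'; case: eqP => // lk.
    by rewrite lk in ls; rewrite ls in ks.
  rewrite (_ : cylinder Y (k :: s) B' = Y k @^-1` B0 `&` cylinder Y s B).
    move=> E; transitivity
      (\int[P]_w (h w * \1_(Y k @^-1` B0 `&` cylinder Y s B) w)%:E)%E.
      by apply: eq_integral => w _; rewrite indicI/= -mulrA [X in h w * X]mulrC.
    rewrite E; under [RHS]eq_integral do rewrite [cst c _]/= EFinM.
    have mk := measurable_preimageT _ _ _ _ _ (mY k) mB0.
    rewrite ge0_integralZl//; last exact/measurable_EFinP.
    by rewrite integral_indic// setIT cE muleCA [RHS]muleC.
  rewrite -sB' /cylinder; apply/seteqP; split=> [w H|w [H1 H2] l /=].
    split; first by have := H k; rewrite /= B'k inE eqxx; apply.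
    by move=> l ls; apply: H; rewrite /= inE ls orbT.
  by rewrite inE => /predU1P[->|/H2//]; rewrite B'k.
have keyT : (\int[P]_w (h w * g (Y k w))%:E =
    (\int[P]_w (h w)%:E) * \int[P]_w (g (Y k w))%:E)%E.
  have := key _ (fun=> measurableT).
  have -> : cylinder Y s (fun=> setT) = setT by apply/seteqP; split.
  under eq_integral do rewrite indicT mulr1.
  by move=> ->; rewrite big1 ?mule1// => l _; rewrite preimage_setT probability_setT.
by split=> [//|B mB]; rewrite key// keyT.
Qed.

(** Starting point of the peeling. The roles are exchanged: the indicator of the cylinder and its
    probability are compared on the events of [h]. *)
Lemma factors_of_indep Y s h :
  (forall k, measurable_fun setT (Y k)) -> mutually_independent P Y -> uniq s ->
  measurable_fun setT h -> (forall w, 0 <= h w) ->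
  (forall A B, gen_sigma Y setT A -> measurable B ->
     P (A `&` h @^-1` B) = (P A * P (h @^-1` B))%E) ->
  factors Y s h.
Proof.
move=> mY iY us mh h0 ih B mB.
have mc := measurable_cylinder _ s _ mY mB.
have cE : (fine (P (cylinder Y s B)))%:E = P (cylinder Y s B).
  by rewrite fineK// fin_num_measure.
(* The function applied to [h] must be non-negative on the whole line, so the absolute value
   replaces the identity. *)
transitivity (\int[P]_w (\1_(cylinder Y s B) w * `|h w|)%:E)%E.
  by apply: eq_integral => w _; rewrite mulrC ger0_norm.
rewrite (ge0_integral_mul_comp_eq _ _ _ _ _ (cst (fine (P (cylinder Y s B)))))//; last 2 first.
- by move=> w; rewrite /= fine_ge0.
- move=> C mC; transitivity (\int[P]_w (\1_(cylinder Y s B `&` h @^-1` C) w)%:E)%E.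
    by apply: eq_integral => w _; rewrite indicI.
  have mhC := measurable_preimageT _ _ _ _ _ mh mC.
  rewrite integral_indic ?setIT//; last exact: measurableI.
  have mcZ : gen_sigma Y setT (cylinder Y s B).
    (* Membership in [gen_sigma Y setT] is measurability in the generated measurable type, which is
       closed under finite intersections. *)
    suff : @measurable _ (g_sigma_algebraType (generators Y)) (cylinder Y s B) by [].
    apply: fin_bigcap_measurable => //= k _.
    apply: (@sub_sigma_algebra _ setT (generators Y)).
    by exists k; [|exists (B k); [exact: mB|]].
  under [RHS]eq_integral do rewrite [cst _ _]/= EFinM.
  rewrite ge0_integralZl//; last 2 first.
  - exact/measurable_EFinP.
  - by rewrite lee_fin fine_ge0.
  by rewrite integral_indic// setIT cE; exact: ih.
under eq_integral do rewrite [cst _ _]/= EFinM.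
rewrite ge0_integralZl//; last 2 first.
- by apply/measurable_EFinP; exact: measurableT_comp.
- by rewrite lee_fin fine_ge0.
rewrite cE muleC; congr (_ * _)%E.
  by apply: eq_integral => w _; rewrite ger0_norm.
exact: iY.
Qed.

End factorization.

Arguments cylinder {R d T I}.
Arguments factors {R d T} P {I}.

Section real_expectations.
Context (R : realType) (d : measure_display) (T : measurableType d).
Variable P : probability T R.

Local Notation L1 f := (P.-integrable setT (EFin \o f)).

Lemma ge0_integrable_lty (f : T -> R) : measurable_fun setT f ->
  (forall w, 0 <= f w) -> (\int[P]_w (f w)%:E < +oo)%E -> L1 f.
Proof.
move=> mf f0 foo; apply/integrableP; split; first exact/measurable_EFinP.
by under eq_integral do rewrite /= ger0_norm//.
Qed.

Lemma integrable_measurable (f : T -> R) : L1 f -> measurable_fun setT f.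
Proof. by move=> /measurable_int/measurable_EFinP. Qed.

Lemma EFin_Rintegral (f : T -> R) : L1 f ->
  (\int[P]_w f w)%:E = (\int[P]_w (f w)%:E)%E.
Proof. by move=> intf; rewrite /Rintegral fineK// integrable_fin_num. Qed.

Lemma integrable_dominated (f g : T -> R) : measurable_fun setT f -> L1 g ->
  (forall w, `|f w| <= g w) -> L1 f.
Proof.
move=> mf intg fg; apply: (@le_integrable _ _ _ _ _ measurableT _ (EFin \o g)) => //.
- exact/measurable_EFinP.
- by move=> w _; rewrite /= lee_fin (le_trans (fg w))// ler_norm.
Qed.

Lemma integrable_cst_fun (c : R) : L1 (fun=> c).
Proof.
exact: (@finite_measure_integrable_cst _ _ _ P setT c).
Qed.

Lemma integrable_addr (f g : T -> R) : L1 f -> L1 g -> L1 (fun w => f w + g w).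
Proof. by move=> If Ig; have := integrableD measurableT If Ig; apply: eq_integrable. Qed.

Lemma integrable_mulr (f : T -> R) (c : R) : L1 f -> L1 (fun w => c * f w).
Proof. by move=> If; have := integrableZl measurableT c If; apply: eq_integrable. Qed.

Lemma Rintegral_sumr (I : Type) (s : seq I) (f : I -> T -> R) : (forall i, L1 (f i)) ->
  L1 (fun w => \sum_(i <- s) f i w) /\
  \int[P]_w (\sum_(i <- s) f i w) = \sum_(i <- s) \int[P]_w f i w.
Proof.
move=> If; elim: s => [|i s [IH1 IH2]].
  split; last by under eq_Rintegral do rewrite big_nil; rewrite big_nil /Rintegral integral0.
  apply: (eq_integrable measurableT (cst 0%E)); last exact: integrable0.
  by move=> w _; rewrite /= big_nil.
split.
  have := integrable_addr _ _ (If i) IH1; apply: eq_integrable => // w _.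
  by rewrite /= big_cons.
under eq_Rintegral do rewrite big_cons.
by rewrite RintegralD// big_cons IH2.
Qed.

Lemma integrable_mul_bounded (f u : T -> R) (c : R) : L1 f ->
  measurable_fun setT u -> (forall w, `|u w| <= c) -> L1 (fun w => f w * u w).
Proof.
move=> intf mu uc.
have intfc : L1 (fun w => `|f w| * c).
  have := integrableZr measurableT c (integrable_norm intf).
  by apply: eq_integrable.
apply: integrable_dominated intfc _.
- by apply: measurable_funM => //; exact: integrable_measurable.
- by move=> w; rewrite normrM ler_wpM2l.
Qed.

Lemma integrable_bounded (u : T -> R) (c : R) : measurable_fun setT u ->
  (forall w, `|u w| <= c) -> L1 u.
Proof.
move=> mu uc; apply: (eq_integrable measurableT (EFin \o (fun w => 1 * u w))).
  by move=> w _; rewrite /= mul1r.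
apply: integrable_mul_bounded mu uc; exact: integrable_cst_fun.
Qed.

Lemma Rintegral_cstT (c : R) : \int[P]_w c = c.
Proof.
transitivity (c * fine (P setT)); first exact: Rintegral_cst.
by rewrite probability_setT mulr1.
Qed.

(** Replaces a non-negative test function by a signed one in a single variable, the weights [h1] and
    [h2] being of any sign; it can therefore be iterated over several variables. *)
Lemma Rintegral_mul_comp_eq_signed (h1 h2 Y : T -> R) (g : R -> R) (c : R) :
  L1 h1 -> L1 h2 -> measurable_fun setT Y ->
  (forall (g' : R -> R) (c' : R), measurable_fun setT g' -> (forall x, 0 <= g' x <= c') ->
    \int[P]_w (h1 w * g' (Y w)) = \int[P]_w (h2 w * g' (Y w))) ->
  measurable_fun setT g -> (forall x, `|g x| <= c) ->
  \int[P]_w (h1 w * g (Y w)) = \int[P]_w (h2 w * g (Y w)).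
Proof.
move=> ih1 ih2 mY heq mg gc.
have c0 : 0 <= c by rewrite (le_trans _ (gc 0)).
have mgY : measurable_fun setT (fun w => g (Y w)) by exact: measurableT_comp.
(* [g + c] is non-negative and bounded *)
have split_shift h : L1 h -> \int[P]_w (h w * g (Y w)) =
    \int[P]_w (h w * (g (Y w) + c)) - \int[P]_w (h w * c).
  move=> ih; rewrite -RintegralB//.
  - by apply: eq_Rintegral => w _; rewrite mulrDr addrK.
  - apply: (integrable_mul_bounded _ _ (c + c)) => //.
    + exact: measurable_funD.
    + by move=> w; rewrite (le_trans (ler_normD _ _))// (ger0_norm c0) lerD2r.
  - exact: (integrable_mul_bounded _ (cst c) `|c|).
rewrite !split_shift//; congr (_ - _).
  apply: (heq (fun x => g x + c) (c + c)); first exact: measurable_funD.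
  by move=> x; have := gc x; rewrite ler_norml => /andP[? ?]; apply/andP; split; lra.
by apply: (heq (cst c) c) => // x; rewrite c0 lexx.
Qed.

Context (I : eqType).
Implicit Types (Y : I -> T -> R) (s : seq I) (h : T -> R).

Lemma factors_mulR Y k s h (g : R -> R) :
  (forall k, measurable_fun setT (Y k)) -> uniq (k :: s) ->
  (forall w, 0 <= h w) -> L1 h -> factors P Y (k :: s) h ->
  measurable_fun setT g -> (forall x, 0 <= g x) -> L1 (fun w => g (Y k w)) ->
  [/\ L1 (fun w => h w * g (Y k w)),
      \int[P]_w (h w * g (Y k w)) = (\int[P]_w h w) * \int[P]_w g (Y k w) &
      factors P Y s (fun w => h w * g (Y k w))].
Proof.
move=> mY us h0 ih fh mg g0 ig.
have mh := integrable_measurable _ ih.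
have hoo : (\int[P]_w (h w)%:E < +oo)%E by exact: integrable_lty ih.
have [E F] := factors_mul _ _ _ _ _ Y k s h g mY us mh h0 hoo fh mg g0.
have ihg : L1 (fun w => h w * g (Y k w)).
  apply: ge0_integrable_lty.
  - by apply: measurable_funM => //; exact: measurableT_comp.
  - by move=> w; rewrite mulr_ge0.
  - by rewrite E -!EFin_Rintegral// -EFinM ltry.
split => //; apply: EFin_inj; rewrite EFinM !EFin_Rintegral//.
Qed.

Lemma factors_mul2R Y k l h (f g : R -> R) :
  (forall k, measurable_fun setT (Y k)) -> k != l ->
  (forall w, 0 <= h w) -> L1 h -> factors P Y [:: k; l] h ->
  measurable_fun setT f -> (forall x, 0 <= f x) -> L1 (fun w => f (Y k w)) ->
  measurable_fun setT g -> (forall x, 0 <= g x) -> L1 (fun w => g (Y l w)) ->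
  L1 (fun w => h w * f (Y k w) * g (Y l w)) /\
  \int[P]_w (h w * f (Y k w) * g (Y l w)) =
    (\int[P]_w h w) * (\int[P]_w f (Y k w)) * \int[P]_w g (Y l w).
Proof.
move=> mY kl h0 ih fh mf f0 If mg g0 Ig.
have us : uniq [:: k; l] by rewrite /= inE kl.
have [i1 e1 f1] := factors_mulR Y k [:: l] h f mY us h0 ih fh mf f0 If.
have h1 w : 0 <= h w * f (Y k w) by rewrite mulr_ge0.
have [i2 e2 f2] := factors_mulR Y l [::] _ g mY isT h1 i1 f1 mg g0 Ig.
by split => //; rewrite e2 e1.
Qed.

(** This kills the cross terms in the second moment of a sum of products. The function [u] has a
    sign, which [factors] does not accept, so [v], that is [u] plus its bound [c], stands in for
    it. *)
Lemma centered_product_orthogonal Y k1 k2 k3 k4 h (u : R -> R) (c : R) :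
  (forall k, measurable_fun setT (Y k)) -> uniq [:: k1; k2; k3; k4] ->
  (forall w, 0 <= h w) -> L1 h -> factors P Y [:: k1; k2; k3; k4] h ->
  measurable_fun setT u -> (forall x, `|u x| <= c) ->
  \int[P]_w u (Y k1 w) = 0 ->
  \int[P]_w (h w * u (Y k1 w) * u (Y k2 w) * u (Y k3 w) * u (Y k4 w)) = 0.
Proof.
move=> mY us h0 ih fh mu uc u0.
have c0 : 0 <= c by rewrite (le_trans _ (uc 0)).
have mgY (g : R -> R) k : measurable_fun setT g -> measurable_fun setT (fun w => g (Y k w)).
  by move=> mg; exact: measurableT_comp.
have bnd (f : T -> R) (g : R -> R) c' k : L1 f -> measurable_fun setT g ->
    (forall x, `|g x| <= c') -> L1 (fun w => f w * g (Y k w)).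
  by move=> If mg gc; apply: (integrable_mul_bounded _ _ c') => //; exact: mgY.
have nn (g : R -> R) c' : (forall x, 0 <= g x <= c') -> forall x, `|g x| <= c'.
  by move=> H x; have /andP[? ?] := H x; rewrite ger0_norm.
have iu k (g : R -> R) c' : measurable_fun setT g -> (forall x, `|g x| <= c') ->
    L1 (fun w => g (Y k w)).
  by move=> mg gc; apply: (integrable_bounded _ c') => //; exact: mgY.
pose v x := u x + c.
have mv : measurable_fun setT v by exact: measurable_funD.
have v0 x : 0 <= v x <= c + c.
  by have := uc x; rewrite ler_norml /v => /andP[? ?]; apply/andP; split; lra.
have Ev : \int[P]_w v (Y k1 w) = c.
  rewrite RintegralD// ?u0 ?add0r; last 2 first.
  - exact: (iu _ _ c).
  - exact: integrable_cst_fun.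
  by rewrite Rintegral_cstT.
have prod4 (g1 g2 g3 g4 : R -> R) (c1 c2 c3 c4 : R) :
    measurable_fun setT g1 -> (forall x, 0 <= g1 x <= c1) ->
    measurable_fun setT g2 -> (forall x, 0 <= g2 x <= c2) ->
    measurable_fun setT g3 -> (forall x, 0 <= g3 x <= c3) ->
    measurable_fun setT g4 -> (forall x, 0 <= g4 x <= c4) ->
    \int[P]_w (h w * g1 (Y k1 w) * g2 (Y k2 w) * g3 (Y k3 w) * g4 (Y k4 w)) =
    (\int[P]_w h w) * (\int[P]_w g1 (Y k1 w)) * (\int[P]_w g2 (Y k2 w)) *
    (\int[P]_w g3 (Y k3 w)) * (\int[P]_w g4 (Y k4 w)).
  move=> m1 b1 m2 b2 m3 b3 m4 b4.
  have p1 x : 0 <= g1 x by case/andP: (b1 x).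
  have p2 x : 0 <= g2 x by case/andP: (b2 x).
  have p3 x : 0 <= g3 x by case/andP: (b3 x).
  have p4 x : 0 <= g4 x by case/andP: (b4 x).
  have /= us2 := us; have /andP[_ us3] := us2; have /andP[_ us4] := us3.
  have [i1 e1 f1] := factors_mulR Y k1 _ h g1 mY us h0 ih fh m1 p1 (iu _ _ _ m1 (nn _ _ b1)).
  have n1 w : 0 <= h w * g1 (Y k1 w) by rewrite mulr_ge0.
  have [i2 e2 f2] := factors_mulR Y k2 _ _ g2 mY us3 n1 i1 f1 m2 p2 (iu _ _ _ m2 (nn _ _ b2)).
  have n2 w : 0 <= h w * g1 (Y k1 w) * g2 (Y k2 w) by rewrite mulr_ge0.
  have [i3 e3 f3] := factors_mulR Y k3 _ _ g3 mY us4 n2 i2 f2 m3 p3 (iu _ _ _ m3 (nn _ _ b3)).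
  have n3 w : 0 <= h w * g1 (Y k1 w) * g2 (Y k2 w) * g3 (Y k3 w) by rewrite mulr_ge0.
  have [i4 e4 f4] := factors_mulR Y k4 [::] _ g4 mY isT n3 i3 f3 m4 p4 (iu _ _ _ m4 (nn _ _ b4)).
  by rewrite e4 e3 e2 e1.
(* Replacing [v (Y k1)] by its mean [c] does not change the expectation when the
   other factors are non-negative; these are then made signed one at a time. *)
have cb : forall x : R, 0 <= cst c x <= c by move=> x; rewrite /= c0 lexx.
have ihv : L1 (fun w => h w * v (Y k1 w)) by apply: (bnd) (nn _ _ v0).
have ihc : L1 (fun w => h w * c).
  by apply: (integrable_mul_bounded _ (cst c) `|c|).
pose e (f : T -> R) := \int[P]_w f w.
have s2 (g3 g4 : R -> R) (c3 c4 : R) : measurable_fun setT g3 -> (forall x, 0 <= g3 x <= c3) ->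
    measurable_fun setT g4 -> (forall x, 0 <= g4 x <= c4) ->
    e (fun w => h w * v (Y k1 w) * u (Y k2 w) * g3 (Y k3 w) * g4 (Y k4 w)) =
    e (fun w => h w * c * u (Y k2 w) * g3 (Y k3 w) * g4 (Y k4 w)).
  move=> m3 b3 m4 b4.
  have sw (f1 : T -> R) : e (fun w => f1 w * u (Y k2 w) * g3 (Y k3 w) * g4 (Y k4 w)) =
      e (fun w => f1 w * g3 (Y k3 w) * g4 (Y k4 w) * u (Y k2 w)).
    by apply: eq_Rintegral => w _; ring.
  rewrite !sw; apply: Rintegral_mul_comp_eq_signed (uc) => //.
  - by apply: (bnd) (nn _ _ b4) => //; apply: (bnd) (nn _ _ b3).
  - by apply: (bnd) (nn _ _ b4) => //; apply: (bnd) (nn _ _ b3).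
  move=> g2 c2 m2 b2.
  transitivity (e (fun w => h w * v (Y k1 w) * g2 (Y k2 w) * g3 (Y k3 w) * g4 (Y k4 w))).
    by apply: eq_Rintegral => w _; ring.
  transitivity (e (fun w => h w * cst c (Y k1 w) * g2 (Y k2 w) * g3 (Y k3 w) * g4 (Y k4 w))).
    rewrite /e (prod4 v g2 g3 g4 _ _ _ _ mv v0 m2 b2 m3 b3 m4 b4).
    rewrite (prod4 (cst c) g2 g3 g4 c _ _ _ _ cb m2 b2 m3 b3 m4 b4)// Ev.
    by rewrite /= Rintegral_cstT.
  by apply: eq_Rintegral => w _; rewrite /=; ring.
have s3 (g4 : R -> R) (c4 : R) : measurable_fun setT g4 -> (forall x, 0 <= g4 x <= c4) ->
    e (fun w => h w * v (Y k1 w) * u (Y k2 w) * u (Y k3 w) * g4 (Y k4 w)) =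
    e (fun w => h w * c * u (Y k2 w) * u (Y k3 w) * g4 (Y k4 w)).
  move=> m4 b4.
  have sw (f1 : T -> R) : e (fun w => f1 w * u (Y k3 w) * g4 (Y k4 w)) =
      e (fun w => f1 w * g4 (Y k4 w) * u (Y k3 w)).
    by apply: eq_Rintegral => w _; ring.
  rewrite !(sw (fun w => _ * u (Y k2 w))); apply: Rintegral_mul_comp_eq_signed (uc) => //.
  - by apply: (bnd) (nn _ _ b4) => //; apply: (bnd) (uc).
  - by apply: (bnd) (nn _ _ b4) => //; apply: (bnd) (uc).
  move=> g3 c3 m3 b3.
  transitivity (e (fun w => h w * v (Y k1 w) * u (Y k2 w) * g3 (Y k3 w) * g4 (Y k4 w))).
    by apply: eq_Rintegral => w _; ring.
  transitivity (e (fun w => h w * c * u (Y k2 w) * g3 (Y k3 w) * g4 (Y k4 w))).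
    exact: s2 m3 b3 m4 b4.
  by apply: eq_Rintegral => w _; ring.
have s4 : e (fun w => h w * v (Y k1 w) * u (Y k2 w) * u (Y k3 w) * u (Y k4 w)) =
    e (fun w => h w * c * u (Y k2 w) * u (Y k3 w) * u (Y k4 w)).
  apply: Rintegral_mul_comp_eq_signed (uc) => //.
  - by apply: (bnd) (uc) => //; apply: (bnd) (uc).
  - by apply: (bnd) (uc) => //; apply: (bnd) (uc).
(* As [u] is [v - c], the integrand is the difference of the two sides of [s4]. *)
transitivity (e (fun w => h w * v (Y k1 w) * u (Y k2 w) * u (Y k3 w) * u (Y k4 w)
   - h w * c * u (Y k2 w) * u (Y k3 w) * u (Y k4 w))).
  by apply: eq_Rintegral => w _; rewrite /v; ring.
rewrite /e RintegralB//; first by rewrite [X in X - _]s4 subrr.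
- by apply: (bnd) (uc) => //; apply: (bnd) (uc) => //; apply: (bnd) (uc).
- by apply: (bnd) (uc) => //; apply: (bnd) (uc) => //; apply: (bnd) (uc).
Qed.

End real_expectations.

(** * Regularly varying tails *)

Section dyadic_tails.
Context (R : realType).
Variables (H : R -> R) (alpha : R).
Hypothesis H_ge0 : forall x, 0 <= H x.
Hypothesis H_anti : forall x y, x <= y -> H y <= H x.
Hypothesis H_gt0 : \forall x \near +oo, 0 < H x.
Hypothesis H_ratio : (fun x => H (2 * x) / H x) @ +oo --> 2 `^ (- alpha).

(** The ratio limit 2^(-alpha) exceeds 2^(-gamma), so far out each doubling of x multiplies x^gamma
    H(x) by at least some r > 1. Monotonicity of [H] supplies a positive lower bound on one dyadic
    block, from which the growth starts. *)
Lemma dyadic_tail_cvgy (gamma : R) : alpha < gamma ->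
  (fun x => x `^ gamma * H x) @ +oo --> +oo.
Proof.
move=> ag.
have [r r1 rlt] : exists2 r : R, 1 < r & r * 2 `^ (- gamma) < 2 `^ (- alpha).
  have E : 2 `^ (- alpha) = 2 `^ (gamma - alpha) * 2 `^ (- gamma) :> R.
    by rewrite -powRD; [congr (_ `^ _); lra|rewrite pnatr_eq0 implybT].
  have g1 : 1 < 2 `^ (gamma - alpha) :> R.
    rewrite -[X in X < _](powRr0 2) /powR pnatr_eq0/= ltr_expR ltr_pM2r ?ln_gt0 ?ltr1n//.
    by rewrite subr_gt0.
  (* The midpoint of 1 and 2^(gamma - alpha). *)
  exists ((1 + 2 `^ (gamma - alpha)) / 2); first by lra.
  by rewrite E ltr_pM2r ?powR_gt0//; lra.
have [x0 [x01 x0H]] : exists x0 : R, 1 <= x0 /\ forall x, x0 <= x ->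
    0 < H x /\ r * 2 `^ (- gamma) * H x <= H (2 * x).
  have [m [_ hm]] := filterI H_gt0 (cvgr_gt _ H_ratio _ rlt).
  exists (Num.max 1 (m + 1)).
  split=> [|x]; first by rewrite le_max lexx.
  rewrite ge_max => /andP[_ mx]; have [|Hx] := hm x; first by lra.
  by rewrite ltr_pdivlMr// => /ltW.
pose G x := x `^ gamma * H x.
have step x : x0 <= x -> r * G x <= G (2 * x).
  move=> xx; have [_ h] := x0H _ xx; rewrite /G powRM; [|lra|lra].
  have e : 2 `^ gamma * (2 `^ (- gamma)) = 1 :> R.
    by rewrite powRN divff// gt_eqF// powR_gt0.
  have p0 : 0 <= 2 `^ gamma * x `^ gamma by rewrite mulr_ge0// powR_ge0.
  apply: le_trans (ler_wpM2l p0 h).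
  rewrite [leRHS](_ : _ = (2 `^ gamma * 2 `^ (- gamma)) * (r * (x `^ gamma * H x))); last by ring.
  by rewrite e mul1r.
(* A lower bound on [x0, 2 x0]: the power is smallest at one of the endpoints, which one depending
   on the sign of [gamma], and [H] is smallest at 2 x0. *)
pose m := Num.min (x0 `^ gamma) ((2 * x0) `^ gamma) * H (2 * x0).
have m0 : 0 < m.
  have [hp _] := x0H (2 * x0) ltac:(lra).
  by rewrite mulr_gt0// lt_min !powR_gt0//; lra.
(* Halving x and using [step], with r > 1, carries the bound [m] from the first block to all later
   ones. *)
have base (j : nat) : forall x, x0 <= x -> x <= 2 ^+ j.+1 * x0 -> m <= G x.
  elim: j => [|j IH] x x0x xj.
    have x2 : x <= 2 * x0 by move: xj; rewrite expr1.
    rewrite /m /G ler_pM//; [by rewrite le_min !powR_ge0| |exact: H_anti].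
    have [g0|/ltW g0] := leP 0 gamma.
      by rewrite ge_min (ge0_ler_powR g0)// nnegrE; lra.
    rewrite ge_min; apply/orP; right.
    rewrite -[gamma]opprK !(powRN _ (- gamma)) lef_pV2 ?posrE ?powR_gt0//; [|lra..].
    by rewrite ge0_ler_powR// ?nnegrE; lra.
  have [x2|x2] := leP x (2 * x0).
    by apply: IH => //; rewrite (le_trans x2)// ler_pM2r; [|lra];
      rewrite exprS ler_peMr// exprn_ege1//; lra.
  have h := step (x / 2) ltac:(lra); rewrite (_ : 2 * (x / 2) = x) in h; last by lra.
  apply: le_trans h; have := IH (x / 2) ltac:(lra).
  rewrite ler_pdivrMr// => /(_ _) hh.
  have {}hh : m <= G (x / 2).
    by apply: hh; rewrite mulrAC -exprSr.
  by rewrite (le_trans hh)// ler_peMl ?ltW// (lt_le_trans m0).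
have grow (k : nat) : forall x, 2 ^+ k * x0 <= x -> r ^+ k * m <= G x.
  elim: k => [|k IH] x; rewrite ?expr0 ?mul1r => kx.
    pose j := Num.truncn x.
    apply: (base j) => //.
    have : x < j.+1%:R by apply: truncnS_gt; rewrite num_real.
    move=> /ltW xj; rewrite (le_trans xj)//.
    apply: (@le_trans _ _ (2 ^+ j.+1)); last by rewrite ler_peMr// exprn_ge0.
    by rewrite -natrX ler_nat ltnW// ltn_expl.
  have h := step (x / 2); rewrite (_ : 2 * (x / 2) = x) in h; last by lra.
  have k1 : 2 ^+ k * x0 <= x / 2 by rewrite ler_pdivlMr// mulrAC -exprSr.
  apply: le_trans (h _).
    by rewrite exprS -mulrA ler_wpM2l ?IH//; lra.
  by apply: le_trans k1; rewrite ler_peMl ?exprn_ege1//; lra.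
apply/cvgryPge => A.
(* By Bernoulli's inequality, r^(k+1) is at least 1 + (k+1)(r - 1), so this [k] makes r^(k+1) m
   reach [A]. *)
pose k := Num.truncn (A / (m * (r - 1))).
have kA : A <= r ^+ k.+1 * m.
  have : A / (m * (r - 1)) < k.+1%:R by apply: truncnS_gt; rewrite num_real.
  rewrite ltr_pdivrMr; last by rewrite mulr_gt0//; lra.
  move=> /ltW h; rewrite (le_trans h)// mulrCA mulrC ler_pM2r//.
  have bernoulli (i : nat) : 1 + i%:R * (r - 1) <= r ^+ i.
    elim: i => [|i IHi]; first by rewrite expr0 mul0r addr0.
    rewrite exprS; apply: le_trans (ler_wpM2l _ IHi); last by lra.
    have : 0 <= i%:R * ((r - 1) * (r - 1)) by rewrite !mulr_ge0//; lra.
    by rewrite -natr1; move: (i%:R : R) => q; nra.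
  by move: (bernoulli k.+1); move: (r ^+ k.+1) (k.+1%:R : R) => u q; lra.
exists (2 ^+ k.+1 * x0); split; first exact: num_real.
by move=> x /ltW /grow; apply: le_trans.
Qed.

(** The mirror image below [alpha]: each doubling now multiplies x^beta H(x) by at most some r < 1.
    The geometric decay makes the dyadic layers of a moment summable. *)
Lemma dyadic_tail_geometric (beta : R) : 0 < beta < alpha ->
  exists x0 rho : R, [/\ 1 <= x0, 0 <= rho < 1 &
    forall k : nat, (2 ^+ k * x0) `^ beta * H (2 ^+ k * x0) <=
                     x0 `^ beta * H x0 * rho ^+ k].
Proof.
move=> /andP[b0 ba].
have [r r01 rlt] : exists2 r : R, 0 <= r < 1 & 2 `^ (- alpha) < r * 2 `^ (- beta).
  have E : 2 `^ (- alpha) = 2 `^ (beta - alpha) * 2 `^ (- beta) :> R.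
    by rewrite -powRD; [congr (_ `^ _); lra|rewrite pnatr_eq0 implybT].
  have g1 : 2 `^ (beta - alpha) < 1 :> R.
    rewrite -[X in _ < X](powRr0 2) /powR pnatr_eq0/= ltr_expR ltr_pM2r ?ln_gt0 ?ltr1n//.
    by rewrite subr_lt0.
  have g0 : 0 < 2 `^ (beta - alpha) :> R by rewrite powR_gt0.
  exists ((1 + 2 `^ (beta - alpha)) / 2); first by lra.
  by rewrite E ltr_pM2r ?powR_gt0//; lra.
have [x0 [x01 x0H]] : exists x0 : R, 1 <= x0 /\ forall x, x0 <= x ->
    H (2 * x) <= r * 2 `^ (- beta) * H x.
  have [m [_ hm]] := filterI H_gt0 (cvgr_lt _ H_ratio _ rlt).
  exists (Num.max 1 (m + 1)).
  split=> [|x]; first by rewrite le_max lexx.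
  rewrite ge_max => /andP[_ mx]; have [|Hx] := hm x; first by lra.
  by rewrite ltr_pdivrMr// => /ltW.
exists x0, r; split => //; elim=> [|k IH]; first by rewrite expr0 !mul1r mulr1.
have kx : x0 <= 2 ^+ k * x0 by rewrite ler_peMl ?exprn_ege1//; lra.
have h := x0H _ kx.
rewrite !exprS -mulrA; set x := 2 ^+ k * x0 in IH kx h *.
rewrite powRM; [|lra|lra].
have e : 2 `^ beta * (2 `^ (- beta)) = 1 :> R.
  by rewrite powRN divff// gt_eqF// powR_gt0.
have p0 : 0 <= 2 `^ beta * x `^ beta by rewrite mulr_ge0// powR_ge0.
apply: le_trans (ler_wpM2l p0 h) _.
rewrite [leLHS](_ : _ = (2 `^ beta * 2 `^ (- beta)) * (r * (x `^ beta * H x))); last by ring.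
by rewrite e mul1r [leRHS]mulrCA ler_wpM2l//; case/andP: r01.
Qed.

End dyadic_tails.

Section tails.
Context (R : realType) (d : measure_display) (T : measurableType d).
Variable P : probability T R.

Lemma Pr_ge0 A : 0 <= Pr P A.
Proof. by rewrite fine_ge0. Qed.

Lemma EFin_Pr A : measurable A -> (Pr P A)%:E = P A.
Proof. by move=> mA; rewrite fineK// fin_num_measure. Qed.

Lemma le_Pr A B : measurable A -> measurable B -> A `<=` B -> Pr P A <= Pr P B.
Proof.
by move=> mA mB AB; rewrite -lee_fin !EFin_Pr// le_measure// inE.
Qed.

Lemma PrU A B : measurable A -> measurable B -> Pr P (A `|` B) <= Pr P A + Pr P B.
Proof.
move=> mA mB; rewrite -lee_fin EFinD !EFin_Pr//; last exact: measurableU.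
exact: measureU2.
Qed.

Lemma Pr_disjointU A B : measurable A -> measurable B -> A `&` B = set0 ->
  Pr P (A `|` B) = Pr P A + Pr P B.
Proof.
move=> mA mB AB; apply: EFin_inj; rewrite EFinD !EFin_Pr//; last exact: measurableU.
by rewrite measureU.
Qed.

Lemma measurable_gt (f : T -> R) x : measurable_fun setT f ->
  measurable [set w | x < f w].
Proof.
move=> mf; rewrite (_ : [set w | _] = f @^-1` `]x, +oo[%classic).
  by apply: measurable_preimageT => //; exact: measurable_itv.
by apply/seteqP; split=> w /=; rewrite in_itv/= andbT.
Qed.

Lemma measurable_lt (f : T -> R) x : measurable_fun setT f ->
  measurable [set w | f w < x].
Proof.
move=> mf; rewrite (_ : [set w | _] = f @^-1` `]-oo, x[%classic).
  by apply: measurable_preimageT => //; exact: measurable_itv.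
by apply/seteqP; split=> w /=; rewrite in_itv/=.
Qed.

Definition tail (W : T -> R) (x : R) : R := Pr P [set w | x < `|W w|].

Lemma measurable_norm_gt (W : T -> R) x : measurable_fun setT W ->
  measurable [set w | x < `|W w|].
Proof. by move=> mW; apply: measurable_gt; exact: measurableT_comp. Qed.

Lemma tail_anti (W : T -> R) x y : measurable_fun setT W -> x <= y ->
  tail W y <= tail W x.
Proof.
move=> mW xy; apply: le_Pr; [exact: measurable_norm_gt..|].
by move=> w /=; apply: le_lt_trans.
Qed.

Lemma tailE (W : T -> R) x : measurable_fun setT W -> 0 <= x ->
  tail W x = Pr P [set w | x < W w] + Pr P [set w | W w < - x].
Proof.
move=> mW x0; rewrite -Pr_disjointU//; [|exact: measurable_gt|exact: measurable_lt|].
  congr (Pr P _); apply/seteqP; split=> w /=; rewrite ltrNr lter_normr.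
    by case/orP; [left|right].
  by case=> ->; rewrite ?orbT.
by apply/seteqP; split=> // w [] /=; lra.
Qed.

(** Because the two tail weights add up to 1, the tail of |W| is equivalent to L(x) x^(-alpha). This
    gives eventual positivity even when one weight is 0, and slow variation at the factor 2 gives
    the ratio. *)
Lemma regularly_varying_tail (W : T -> R) (alpha : R) : measurable_fun setT W ->
  regularly_varying P W alpha ->
  (\forall x \near +oo, 0 < tail W x) /\
  (fun x => tail W (2 * x) / tail W x) @ +oo --> 2 `^ (- alpha).
Proof.
move=> mW [pp [pm [L [[pp0 pm0] ppm [Lpos Lsv] cp cm]]]].
pose q x : R := L x * x `^ (- alpha).
have c1 : (fun x => tail W x / q x) @ +oo --> (1 : R).
  rewrite -ppm; apply: cvg_trans (cvgD cp cm).
  apply: near_eq_cvg; exists 0; split => // x x0.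
  by rewrite tailE ?ltW// mulrDl.
have q0 : \forall x \near +oo, 0 < q x.
  have : \forall x \near +oo, (0 : R) < x by exact: nbhs_pinfty_gt.
  move=> /(filterI Lpos); apply: filterS => x [? ?].
  by rewrite mulr_gt0// powR_gt0.
have H0 : \forall x \near +oo, 0 < tail W x.
  have h : \forall x \near +oo, 0 < tail W x / q x by exact: (cvgr_gt _ c1 _ ltr01).
  move: q0 => /(filterI h); apply: filterS => x [+ qx].
  by rewrite pmulr_lgt0// invr_gt0.
split => //.
have two : (fun x : R => 2 * x) @ +oo --> +oo.
  by apply: gt0_cvgMry => //; exact: cvg_id.
have c2 : (fun x => tail W (2 * x) / q (2 * x)) @ +oo --> (1 : R).
  exact: (cvg_comp _ _ two c1).
have c3 : (fun x => L (2 * x) / L x * 2 `^ (- alpha)) @ +oo --> (1 * 2 `^ (- alpha) : R).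
  by apply: cvgM; [exact: Lsv|exact: cvg_cst].
(* Once all denominators are non-zero, this product telescopes to the wanted ratio. *)
have c4 : (fun x => tail W (2 * x) / q (2 * x) * (L (2 * x) / L x * 2 `^ (- alpha)) *
    (tail W x / q x)^-1) @ +oo --> (1 * (1 * 2 `^ (- alpha)) * 1^-1 : R).
  by apply: cvgM; [exact: cvgM|apply: cvgV => //; exact: oner_neq0].
rewrite mul1r invr1 mulr1 mul1r in c4.
apply: cvg_trans c4; apply: near_eq_cvg.
have x0 : \forall x \near +oo, (0 : R) < x by exact: nbhs_pinfty_gt.
have q2 : \forall x \near +oo, 0 < q (2 * x) by exact: (two _ q0).
move: Lpos => /(filterI x0)/(filterI q0)/(filterI q2)/(filterI H0).
apply: filterS => x [Hx [q2x [qx [xx Lx]]]].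
have qE : q (2 * x) = L (2 * x) * (2 `^ (- alpha) * x `^ (- alpha)).
  by rewrite /q powRM// ltW.
have q2n : q (2 * x) != 0 by rewrite gt_eqF.
have L2n : L (2 * x) != 0.
  by apply/eqP => L0; move: q2n; rewrite qE L0 mul0r eqxx.
have Lxn : L x != 0 by rewrite gt_eqF.
have Hxn : tail W x != 0 by rewrite gt_eqF.
have an : 2 `^ (- alpha) != 0 :> R by rewrite gt_eqF// powR_gt0.
have xn : x `^ (- alpha) != 0 :> R by rewrite gt_eqF// powR_gt0.
rewrite qE /q.
by field; rewrite L2n Lxn Hxn an xn.
Qed.

(** Above [x0], |W|^beta is dominated by a sum of indicators of the events |W| > 2^k x0, weighted by
    (2^(k+1) x0)^beta; their expectations decay geometrically. *)
Lemma regularly_varying_moment (W : T -> R) (alpha beta : R) :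
  measurable_fun setT W -> regularly_varying P W alpha -> 0 < beta < alpha ->
  (\int[P]_w (`|W w| `^ beta)%:E < +oo)%E.
Proof.
move=> mW /(regularly_varying_tail _ _ mW) [H0 Hr] ba.
have [x0 [rho [x01 r01 Hk]]] := dyadic_tail_geometric _ _ _ H0 Hr _ ba.
have b0 : 0 <= beta by case/andP: ba => /ltW.
pose x k : R := 2 ^+ k * x0.
have xpos k : 0 < x k by rewrite mulr_gt0 ?exprn_gt0//; lra.
(* dyadic layers of [|W|] above [x0] *)
pose f k w : \bar R := (2 `^ beta * x k `^ beta * \1_[set w | x k < `|W w|] w)%:E.
have mS k : measurable [set w | x k < `|W w|] by exact: measurable_norm_gt.
have mf k : measurable_fun setT (f k).
  by apply/measurable_EFinP/measurable_funM.
have f0 k w : (0 <= f k w)%E by rewrite lee_fin !mulr_ge0// powR_ge0.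
have bound w : ((`|W w| `^ beta)%:E <= (x0 `^ beta)%:E + \sum_(k <oo) f k w)%E.
  have [Wx|Wx] := leP `|W w| x0.
    rewrite -[leLHS]adde0 leeD//; last by apply: nneseries_ge0 => *; exact: f0.
    by rewrite lee_fin ge0_ler_powR ?nnegrE//; lra.
  have ex : exists k, `|W w| <= x k.
    exists (Num.truncn `|W w|).+1.
    have : `|W w| < (Num.truncn `|W w|).+1%:R by apply: truncnS_gt; rewrite num_real.
    move=> /ltW h; rewrite (le_trans h)//.
    apply: (@le_trans _ _ (2 ^+ (Num.truncn `|W w|).+1)); last by rewrite ler_peMr// exprn_ge0.
    by rewrite -natrX ler_nat ltnW// ltn_expl.
  (* By minimality |W| lies between x_k and x_(k+1), which is 2 x_k, so layer k alone dominates;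
     index 0 is excluded by |W| > x0. *)
  case: (ex_minnP ex) => -[|k] Wk kmin.
    by move: Wk; rewrite /x expr0 mul1r leNgt Wx.
  have xk : x k < `|W w|.
    by rewrite ltNge; apply/negP => /kmin; rewrite ltnn.
  rewrite -[leLHS]add0e leeD// ?lee_fin ?powR_ge0//.
  apply: (@le_trans _ _ (\sum_(0 <= i < k.+1) f i w)%E); last first.
    by apply: nneseries_lim_ge => *; exact: f0.
  rewrite big_nat_recr//= -[leLHS]add0e leeD//.
    by apply: sume_ge0 => *; exact: f0.
  rewrite lee_fin indicE mem_set// mulr1 -powRM ?(ltW (xpos _))//.
  rewrite ge0_ler_powR ?nnegrE ?mulr_ge0 ?(ltW (xpos _))//.
    by rewrite (le_trans _ x01).
  by apply: le_trans Wk _; rewrite /x exprS mulrA.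
have m1 : measurable_fun setT (fun w => (`|W w| `^ beta)%:E).
  apply/measurable_EFinP; apply: (measurableT_comp (measurable_powR beta)).
  exact: measurableT_comp.
have mS' : measurable_fun setT (fun w => \sum_(k <oo) f k w)%E.
  by apply: ge0_emeasurable_sum => // *; exact: f0.
apply: (@le_lt_trans _ _ (\int[P]_w ((x0 `^ beta)%:E + \sum_(k <oo) f k w))%E).
  by apply: ge0_le_integral => //; apply: emeasurable_funD.
rewrite ge0_integralD//; last 2 first.
- by move=> w _; rewrite lee_fin powR_ge0.
- by move=> w _; apply: nneseries_ge0 => *; exact: f0.
have -> : (\int[P]_w (x0 `^ beta)%:E = (x0 `^ beta)%:E)%E.
  transitivity ((x0 `^ beta)%:E * P setT)%E; first exact: integral_cst.
  by rewrite probability_setT mule1.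
rewrite integral_nneseries//.
set C := 2 `^ beta * (x0 `^ beta * tail W x0).
have intf k : (\int[P]_w f k w <= (C * rho ^+ k)%:E)%E.
  rewrite /f; under eq_integral do rewrite EFinM.
  rewrite ge0_integralZl//; last 2 first.
  - exact/measurable_EFinP.
  - by rewrite lee_fin mulr_ge0// powR_ge0.
  have -> : (\int[P]_w (\1_[set w | (x k < `|W w|)%R] w)%:E)%E = (tail W (x k))%:E.
    by rewrite integral_indic// setIT; apply/esym; exact: EFin_Pr.
  rewrite -EFinM lee_fin /C -!mulrA.
  by rewrite ler_wpM2l ?powR_ge0// mulrA; exact: Hk.
have [r0 r1] := andP r01.
have C0 : 0 <= C by rewrite !mulr_ge0 ?powR_ge0 ?Pr_ge0.
have r1n : rho != 1 by rewrite lt_eqF.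
apply: (@le_lt_trans _ _ ((x0 `^ beta)%:E + (C / (1 - rho))%:E)%E); last first.
  by rewrite -EFinD ltry.
rewrite leeD2l//; apply: lime_le.
  by apply: is_cvg_nneseries => *; rewrite integral_ge0.
apply: nearW => n; apply: (@le_trans _ _ (\sum_(0 <= k < n) (C * rho ^+ k)%:E)%E).
  exact: lee_sum.
rewrite sumEFin lee_fin.
have := geometric_seriesE C r1n; rewrite /series/= => /(congr1 (@^~ n)) /= ->.
rewrite ler_pM2r ?invr_gt0 ?subr_gt0// ler_piMr// gerBl exprn_ge0//.
Qed.

End tails.
Arguments tail {R d T} P W x.

(** * Growth of the normalizing sequence *)

Section normalizing_sequence.
Context (R : realType).
Variables (H : R -> R) (alpha : R) (a : nat -> R).
Hypothesis H_anti : forall x y, x <= y -> H y <= H x.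
Hypothesis H_cvgy : forall gamma, alpha < gamma ->
  (fun x => x `^ gamma * H x) @ +oo --> +oo.
Hypothesis Ha : (fun n => n%:R * H (a n)) @ \oo --> (1 : R).

(** If [a n] stayed below M, then n H(a_n) would be at least n H(M), which is unbounded because H(M)
    > 0: a monotone [H] vanishing at M would vanish beyond it, contrary to [H_cvgy]. *)
Lemma normalizing_cvgy : a @ \oo --> +oo.
Proof.
apply/cvgryPgt => M.
have HM : 0 < H M.
  have /cvgryPgt/(_ 0) [m [_ hm]] := H_cvgy (alpha + 1) ltac:(lra).
  pose x := Num.max M (m + 1).
  have : 0 < x `^ (alpha + 1) * H x by apply: hm; rewrite /x lt_max; apply/orP; right; lra.
  move=> h; apply: (@lt_le_trans _ _ (H x)); last by apply: H_anti; rewrite /x le_max lexx.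
  by move: h; rewrite pmulr_rgt0// lt_neqAle powR_ge0 andbT eq_sym; apply/negP => /eqP x0;
     move: (hm x); rewrite x0 mul0r ltxx /x lt_max ltrDl ltr01 orbT => /(_ isT).
have h2 : \forall n \near \oo, n%:R * H (a n) < 2.
  by apply: (cvgr_lt _ Ha); rewrite ltr1n.
have h3 : \forall n \near \oo, 2 / H M < n%:R :> R.
  by have /cvgryPgt := @cvgr_idn R; apply.
move: h2 => /(filterI h3); apply: filterS => n [h h'].
rewrite ltNge; apply/negP => /H_anti HaM.
move: h; rewrite ltr_pdivrMr// => h.
have : n%:R * H M <= n%:R * H (a n) by rewrite ler_wpM2l.
by lra.
Qed.

(** The quantity is n H(a_n), which is bounded, divided by a_n^gamma H(a_n), which diverges. *)
Lemma normalizing_rate (gamma : R) : alpha < gamma ->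
  (fun n => n%:R * a n `^ (- gamma)) @ \oo --> (0 : R).
Proof.
move=> ag; have ay := normalizing_cvgy.
have c : (fun n => a n `^ gamma * H (a n)) @ \oo --> +oo.
  exact: (cvg_comp _ _ ay (H_cvgy _ ag)).
apply/cvgrPdist_lt => e e0.
have h1 : \forall n \near \oo, n%:R * H (a n) < 2.
  by apply: (cvgr_lt _ Ha); rewrite ltr1n.
have h2 : \forall n \near \oo, 2 / e < a n `^ gamma * H (a n).
  by move/cvgryPgt : c; apply.
have h3 : \forall n \near \oo, 0 < a n by move/cvgryPgt : ay; apply.
move: h1 => /(filterI h2)/(filterI h3); apply: filterS => n [a0 [hG hn]].
have p0 : 0 < a n `^ gamma by rewrite powR_gt0.
rewrite sub0r normrN ger0_norm ?mulr_ge0 ?powR_ge0// powRN ltr_pdivrMr//.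
have Hn0 : 0 < H (a n).
  have : 0 < a n `^ gamma * H (a n) by apply: lt_trans hG; rewrite divr_gt0.
  by rewrite pmulr_rgt0.
rewrite -(ltr_pM2r Hn0) (lt_trans hn)//.
rewrite [ltRHS](_ : _ = a n `^ gamma * H (a n) * e); last by ring.
by rewrite -ltr_pdivrMr.
Qed.

(** Carries the divergence from the tail of Z to that of the product; [kappa] will be the
    probability that the volatility exceeds [s]. *)
Lemma scaled_tail_cvgy (H' : R -> R) (kappa s : R) : 0 < kappa -> 0 < s ->
  (forall x : R, 0 < x -> kappa * H (x / s) <= H' x) ->
  forall gamma, alpha < gamma -> (fun x => x `^ gamma * H' x) @ +oo --> +oo.
Proof.
move=> k0 s0 HH' gamma ag.
have c1 : (fun x : R => s^-1 * x) @ +oo --> +oo.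
  by apply: gt0_cvgMry; [rewrite invr_gt0|exact: cvg_id].
have c2 := cvg_comp _ _ c1 (H_cvgy _ ag).
have c3 : (fun x => (kappa * s `^ gamma) * ((s^-1 * x) `^ gamma * H (s^-1 * x))) @ +oo --> +oo.
  by apply: gt0_cvgMry => //; rewrite mulr_gt0// powR_gt0.
apply/cvgryPge => A.
have h1 : \forall x \near +oo, A <= (kappa * s `^ gamma) * ((s^-1 * x) `^ gamma * H (s^-1 * x)).
  by move/cvgryPge : c3; apply.
have h2 : \forall x \near +oo, (0 : R) < x by exact: nbhs_pinfty_gt.
move: h1 => /(filterI h2); apply: filterS => x [x0 hx].
apply: (le_trans hx).
rewrite powRM ?invr_ge0 ?(ltW s0) ?(ltW x0)//.
have e : s `^ gamma * s^-1 `^ gamma = 1.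
  by rewrite -powRM ?invr_ge0 ?(ltW s0)// divff ?gt_eqF// powR1.
rewrite [leLHS](_ : _ = (s `^ gamma * s^-1 `^ gamma) * (x `^ gamma * (kappa * H (s^-1 * x)))); last by ring.
by rewrite e mul1r ler_wpM2l ?powR_ge0// [X in H X]mulrC HH'.
Qed.

End normalizing_sequence.

(** * Probability bounds for sums of products *)

Lemma powR_sum_le (R : realType) (beta : R) (I : Type) (s : seq I) (f : I -> R) :
  0 < beta <= 1 -> `|\sum_(i <- s) f i| `^ beta <= \sum_(i <- s) `|f i| `^ beta.
Proof.
move=> /andP[b0 b1].
have two (x y : R) : 0 <= x -> 0 <= y -> (x + y) `^ beta <= x `^ beta + y `^ beta.
  move=> x0 y0; have := addr_ge0 x0 y0; rewrite le_eqVlt => /predU1P[<-|xy0].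
    by rewrite powR0 ?gt_eqF// addr_ge0 ?powR_ge0.
  (* A number t in [0, 1] satisfies t <= t^beta; applied to the shares of x and y in x + y, which
     add up to 1. *)
  have frac z : 0 <= z -> z <= x + y -> z / (x + y) * (x + y) `^ beta <= z `^ beta.
    move=> z0 zxy; rewrite -[X in _ <= X `^ _](divfK (lt0r_neq0 xy0)).
    have r0 : 0 <= z / (x + y) by rewrite divr_ge0// ltW.
    rewrite powRM ?(ltW xy0)// ler_wpM2r ?powR_ge0//.
    have r1 : z / (x + y) <= 1 by rewrite ler_pdivrMr// mul1r.
    have [->|rn] := eqVneq (z / (x + y)) 0; first by rewrite powR_ge0.
    by rewrite ger1_powR// r1 lt0r rn r0.
  have := lerD (frac x x0 _) (frac y y0 _).
  rewrite -mulrDl -mulrDl divff ?gt_eqF// mul1r; apply.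
    by rewrite lerDl.
  by rewrite lerDr.
elim: s => [|i s IH]; first by rewrite !big_nil normr0 powR0 ?gt_eqF.
rewrite !big_cons; apply: le_trans (_ : (`|f i| + `|\sum_(j <- s) f j|) `^ beta <= _).
  by rewrite ge0_ler_powR ?nnegrE ?addr_ge0 ?ler_normD// ltW.
by apply: le_trans (two _ _ _ _) _ => //; rewrite lerD2l.
Qed.

Section markov.
Context (R : realType) (d : measure_display) (T : measurableType d).
Variable P : probability T R.
Local Notation L1 f := (P.-integrable setT (EFin \o f)).

Lemma Pr_le_expectation (A : set T) (g : T -> R) (c : R) :
  measurable A -> L1 g -> (forall w, 0 <= g w) -> 0 < c ->
  (forall w, A w -> c <= g w) -> Pr P A <= (\int[P]_w g w) / c.
Proof.
move=> mA ig g0 c0 Ag; rewrite ler_pdivlMr// mulrC.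
have -> : c * Pr P A = \int[P]_w (c * \1_A w).
  rewrite RintegralZl//; last exact: integrable_indic.
  by congr (_ * _); rewrite /Rintegral integral_indic// setIT.
apply: le_Rintegral => //.
- have := integrable_mul_bounded _ _ _ P (cst c) \1_A 1 (integrable_cst_fun _ _ _ _ c).
  apply=> // w; rewrite indicE; case: (w \in A); rewrite ?normr1 ?normr0//.
- move=> w _; rewrite indicE; case: (boolP (w \in A)) => [/set_mem/Ag|_].
    by rewrite mulr1.
  by rewrite mulr0.
Qed.

Lemma ge0_integral_ident (Y Y' : T -> R) (g : R -> R) :
  measurable_fun setT Y -> measurable_fun setT Y' ->
  (forall B, measurable B -> P (Y @^-1` B) = P (Y' @^-1` B)) ->
  measurable_fun setT g -> (forall x, 0 <= g x) ->
  (\int[P]_w (g (Y w))%:E = \int[P]_w (g (Y' w))%:E)%E.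
Proof.
move=> mY mY' YY' mg g0.
have mgE : measurable_fun [set: R] (EFin \o g) by exact/measurable_EFinP.
have e W : measurable_fun setT W -> (\int[P]_w (g (W w))%:E =
    \int[pushforward P W]_y (g y)%:E)%E.
  by move=> mW; rewrite ge0_integral_pushforward// => y _; rewrite lee_fin.
rewrite !e//; apply: eq_measure_integral => B mB _.
exact: YY'.
Qed.

Lemma ge0_integrable_ident (Y Y' : T -> R) (g : R -> R) :
  measurable_fun setT Y -> measurable_fun setT Y' ->
  (forall B, measurable B -> P (Y @^-1` B) = P (Y' @^-1` B)) ->
  measurable_fun setT g -> (forall x, 0 <= g x) ->
  L1 (fun w => g (Y w)) ->
  L1 (fun w => g (Y' w)) /\ \int[P]_w g (Y' w) = \int[P]_w g (Y w).
Proof.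
move=> mY mY' YY' mg g0 ig.
have e := ge0_integral_ident _ _ _ mY mY' YY' mg g0.
have ig' : L1 (fun w => g (Y' w)).
  apply: ge0_integrable_lty => //; first exact: measurableT_comp.
  by rewrite -e; exact: integrable_lty ig.
by split => //; apply: EFin_inj; rewrite !EFin_Rintegral.
Qed.

Lemma bounded_Rintegral_ident (Y Y' : T -> R) (u : R -> R) (c : R) :
  measurable_fun setT Y -> measurable_fun setT Y' ->
  (forall B, measurable B -> P (Y @^-1` B) = P (Y' @^-1` B)) ->
  measurable_fun setT u -> (forall x, `|u x| <= c) ->
  \int[P]_w u (Y w) = \int[P]_w u (Y' w).
Proof.
move=> mY mY' YY' mu uc.
have m W : measurable_fun setT W -> measurable_fun setT (fun w : T => u (W w)).
  by move=> mW; exact: measurableT_comp.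
have iu W : measurable_fun setT W -> L1 (fun w => u (W w)).
  by move=> mW; apply: (integrable_bounded _ _ _ _ _ c) => //; exact: m.
have e W : measurable_fun setT W ->
    \int[P]_w u (W w) = \int[P]_w (u (W w) + c) - c.
  move=> mW; rewrite RintegralD//; last 2 first.
  - exact: iu.
  - exact: integrable_cst_fun.
  by rewrite Rintegral_cstT addrK.
rewrite !e//; congr (_ - _).
have v0 x : 0 <= u x + c by have := uc x; rewrite ler_norml => /andP[? ?]; lra.
have mv : measurable_fun setT (fun x => u x + c) by exact: measurable_funD.
have iv : L1 (fun w => u (Y' w) + c).
  by apply: integrable_addr; [exact: iu|exact: integrable_cst_fun].
have Y'Y B : measurable B -> P (Y' @^-1` B) = P (Y @^-1` B) by move=> mB; rewrite YY'.
by have [_] := ge0_integrable_ident Y' Y (fun x => u x + c) mY' mY Y'Y mv v0 iv.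
Qed.

End markov.

Lemma powR_le_1D (R : realType) (x beta : R) : 0 <= x -> 0 <= beta -> beta <= 1 ->
  x `^ beta <= 1 + x.
Proof.
move=> x0 b0 b1; have [x1|x1] := leP x 1.
  apply: (@le_trans _ _ 1); last by rewrite lerDl.
  have <- : 1 `^ beta = 1 :> R by rewrite powR1.
  by rewrite ge0_ler_powR ?nnegrE.
by apply: (@le_trans _ _ x); rewrite ?lerDr ?ler1_powR ?(ltW x1).
Qed.

Lemma le_1D_powR (R : realType) (x beta : R) : 0 <= x -> 1 <= beta ->
  x <= 1 + x `^ beta.
Proof.
move=> x0 b1; have [x1|x1] := leP x 1.
  by apply: (le_trans x1); rewrite lerDl powR_ge0.
by apply: (@le_trans _ _ (x `^ beta)); rewrite ?lerDr ?le1r_powR ?(ltW x1).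
Qed.

Lemma mulr_le_pow4 (R : realFieldType) (x y : R) :
  x * y <= 1 + x ^+ 4 + y ^+ 4.
Proof.
have := sqr_ge0 (x - y); have := sqr_ge0 (x ^+ 2 - 1); have := sqr_ge0 (y ^+ 2 - 1).
by have := sqr_ge0 (x ^+ 2); have := sqr_ge0 (y ^+ 2); nra.
Qed.

Lemma sqr_mulr_le_pow4 (R : realFieldType) (x y : R) :
  (x * y) ^+ 2 <= x ^+ 4 + y ^+ 4.
Proof. by have := sqr_ge0 (x ^+ 2 - y ^+ 2); have := sqr_ge0 (x ^+ 2 + y ^+ 2); nra. Qed.

(** * Truncation and centring *)

Section truncation.
Context (R : realType) (d : measure_display) (T : measurableType d).
Variable P : probability T R.
Local Notation L1 f := (P.-integrable setT (EFin \o f)).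

Definition truncate (c x : R) : R := if `|x| <= c then x else 0.

Lemma measurable_truncate c : measurable_fun setT (truncate c).
Proof.
apply: measurable_fun_ifT => //.
by apply: measurable_fun_ler => //; exact: measurable_cst.
Qed.

Lemma truncate_norm c x : `|truncate c x| <= `|x|.
Proof. by rewrite /truncate; case: ifP => // _; rewrite normr0. Qed.

Lemma truncate_bounded c x : 0 <= c -> `|truncate c x| <= c.
Proof. by move=> c0; rewrite /truncate; case: ifP => // _; rewrite normr0. Qed.

(** Where |x| <= c, split x^2 into |x|^(2 - beta) |x|^beta and bound the first factor through its
    non-negative exponent. *)
Lemma truncate_sqr_le (c x beta : R) : 0 < c -> beta <= 2 ->
  truncate c x ^+ 2 <= c `^ (2 - beta) * `|x| `^ beta.
Proof.
move=> c0 b2; rewrite /truncate; case: ifP => xc; last first.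
  by rewrite expr0n mulr_ge0// powR_ge0.
have [->|x0] := eqVneq x 0; first by rewrite expr0n mulr_ge0// powR_ge0.
have nx : 0 < `|x| by rewrite normr_gt0.
have -> : x ^+ 2 = `|x| `^ (2 - beta) * `|x| `^ beta.
  by rewrite -powRD ?(gt_eqF nx) ?implybT// subrK powR_mulrn// real_normK// num_real.
rewrite ler_wpM2r ?powR_ge0//.
by rewrite ge0_ler_powR ?nnegrE ?subr_ge0// ltW.
Qed.

(** Where |x| > c, split |x| into |x|^(1 - beta) |x|^beta; the exponent 1 - beta is at most 0, so
    the first factor is largest at c. *)
Lemma truncate_rest_le (c x beta : R) : 0 < c -> 1 <= beta ->
  `|x - truncate c x| <= c `^ (1 - beta) * `|x| `^ beta.
Proof.
move=> c0 b1; rewrite /truncate; case: ifPn => xc.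
  by rewrite subrr normr0 mulr_ge0// powR_ge0.
rewrite -ltNge in xc; have nx := lt_trans c0 xc.
have -> : `|x - 0| = `|x| `^ (1 - beta) * `|x| `^ beta.
  by rewrite -powRD ?(gt_eqF nx) ?implybT// subrK powRr1// subr0.
rewrite ler_wpM2r ?powR_ge0//.
rewrite -[1 - beta]opprK !(powRN _ (- _)) lef_pV2 ?posrE ?powR_gt0//.
by rewrite ge0_ler_powR ?nnegrE ?(ltW c0) ?(ltW nx) ?(ltW xc)//; lra.
Qed.

(** A function on the line, so that it can be composed with every variable having the law of [W]. *)
Definition centered_truncate (W : T -> R) (c x : R) : R :=
  truncate c x - \int[P]_w truncate c (W w).

(** Centring costs no more than truncating: as [W] has mean zero, the mean of the truncated variable
    is minus the mean of the discarded part, hence also of order c^(1 - beta). This is the source of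
    the factor 2 in the bound on [W w - u (W w)]. *)
Lemma centered_truncation_bounds (W : T -> R) (beta c m : R) :
  L1 W -> \int[P]_w W w = 0 -> 1 <= beta <= 2 -> 1 <= c ->
  L1 (fun w => `|W w| `^ beta) -> \int[P]_w (`|W w| `^ beta) = m ->
  let u := centered_truncate W c in
  [/\ (forall x, `|u x| <= c + c), \int[P]_w u (W w) = 0,
      \int[P]_w (u (W w) ^+ 2) <= (2 * m + 2 * (1 + m) ^+ 2) * c `^ (2 - beta),
      \int[P]_w `|u (W w)| <= 2 * (1 + m) &
      \int[P]_w `|W w - u (W w)| <= 2 * m * c `^ (1 - beta) ] /\
  \int[P]_w `|W w| <= 1 + m.
Proof.
move=> iW W0 /andP[b1 b2] c1 iB Em.
have c0 : 0 < c by lra.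
have mW := integrable_measurable _ _ _ _ _ iW.
have mt : measurable_fun setT (fun w => truncate c (W w)).
  exact: (measurableT_comp (measurable_truncate c)).
have it : L1 (fun w => truncate c (W w)).
  by apply: (integrable_bounded _ _ _ _ _ c) => // w; exact: truncate_bounded (ltW c0).
set mu := \int[P]_w truncate c (W w).
move=> u.
have iu : L1 (fun w => u (W w)).
  by apply: (integrable_addr _ _ _ _ _ (cst (- mu))) => //; exact: integrable_cst_fun.
have m0 : 0 <= m by rewrite -Em; apply: Rintegral_ge0 => w _; exact: powR_ge0.
have inW : L1 (fun w => `|W w|) by exact: integrable_norm iW.
have ED : \int[P]_w `|W w| <= 1 + m.
  rewrite -Em -[X in _ <= X + _](Rintegral_cstT _ _ _ P) -RintegralD//; last first.
    exact: integrable_cst_fun.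
  apply: le_Rintegral => //.
    by apply: integrable_addr => //; exact: integrable_cst_fun.
  by move=> w _; exact: le_1D_powR.
have int' : L1 (fun w => `|truncate c (W w)|) by exact: integrable_norm it.
have muD : `|mu| <= \int[P]_w `|W w|.
  apply: le_trans (le_normr_Rintegral _ it) _ => //.
  by apply: le_Rintegral => // w _; exact: truncate_norm.
have muc : `|mu| <= c.
  apply: le_trans (le_normr_Rintegral _ it) _ => //.
  rewrite -[leRHS](Rintegral_cstT _ _ _ P); apply: le_Rintegral => //.
    exact: integrable_cst_fun.
  by move=> w _; exact: truncate_bounded (ltW c0).
have pc : 0 <= c `^ (1 - beta) by exact: powR_ge0.
pose v w := W w - truncate c (W w).
have iv : L1 v.
  have := integrable_addr _ _ _ _ _ _ iW (integrable_mulr _ _ _ _ _ (-1) it).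
  by apply: eq_integrable => // w _; rewrite /= /v mulN1r.
have inv : L1 (fun w => `|v w|) by exact: integrable_norm iv.
have Ev : \int[P]_w `|v w| <= m * c `^ (1 - beta).
  rewrite -Em mulrC -RintegralZl//; apply: le_Rintegral => //.
    exact: integrable_mulr.
  by move=> w _; exact: truncate_rest_le.
have muv : `|mu| <= \int[P]_w `|v w|.
  have -> : mu = - \int[P]_w v w by rewrite RintegralB//= W0 sub0r opprK.
  by rewrite normrN; exact: le_normr_Rintegral.
split => //; split.
- move=> x; apply: le_trans (ler_normB _ _) _; apply: lerD => //.
  exact: truncate_bounded (ltW c0).
- rewrite /u /centered_truncate -/mu RintegralB//=; last exact: integrable_cst_fun.
  by rewrite Rintegral_cstT subrr.
- have iub : L1 (fun w => u (W w) ^+ 2).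
    apply: (integrable_bounded _ _ _ _ _ ((c + c) ^+ 2)).
      by apply: measurable_funX; exact: integrable_measurable iu.
    move=> w; rewrite ger0_norm ?sqr_ge0// -(real_normK (num_real (u _))).
    rewrite lerXn2r ?nnegrE//; first by lra.
    apply: le_trans (ler_normB _ _) _; apply: lerD => //.
    exact: truncate_bounded (ltW c0).
  have ir : L1 (fun w => 2 * c `^ (2 - beta) * `|W w| `^ beta) by exact: integrable_mulr.
  apply: (@le_trans _ _ (\int[P]_w (2 * c `^ (2 - beta) * `|W w| `^ beta + 2 * mu ^+ 2))).
    apply: le_Rintegral => //.
      by apply: integrable_addr => //; exact: integrable_cst_fun.
    move=> w _; have := truncate_sqr_le c (W w) beta c0 b2.
    rewrite /u /centered_truncate -/mu; move: (truncate c (W w)) (c `^ (2 - beta)) (`|W w| `^ beta) => x y z h.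
    by have := sqr_ge0 (x + mu); nra.
  rewrite RintegralD//=; last exact: integrable_cst_fun.
  rewrite RintegralZl//= Em Rintegral_cstT.
  (* Lets the constant coming from [mu ^+ 2] be absorbed into the power of c. *)
  have p1 : 1 <= c `^ (2 - beta).
    by rewrite -[leLHS](powRr0 c) ler_powR// subr_ge0.
  have : mu ^+ 2 <= (1 + m) ^+ 2.
    rewrite -(real_normK (num_real mu)) lerXn2r ?nnegrE//; first by lra.
    exact: le_trans muD ED.
  have : 0 <= (1 + m) ^+ 2 by exact: sqr_ge0.
  move: ((1 + m) ^+ 2) (mu ^+ 2) (c `^ (2 - beta)) p1 => x y z; nra.
- apply: (@le_trans _ _ (\int[P]_w (`|W w| + `|mu|))).
    apply: le_Rintegral => //.
    + exact: integrable_norm iu.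
    + by apply: integrable_addr => //; exact: integrable_cst_fun.
    move=> w _; apply: le_trans (ler_normB _ _) _; rewrite lerD2r.
    exact: truncate_norm.
  rewrite RintegralD//=; last exact: integrable_cst_fun.
  by rewrite Rintegral_cstT; lra.
- apply: (@le_trans _ _ (\int[P]_w (`|v w| + `|mu|))).
    apply: le_Rintegral => //.
    + apply: integrable_norm.
      have := integrable_addr _ _ _ _ _ _ iv (integrable_cst_fun _ _ _ P mu).
      by apply: eq_integrable => // w _; rewrite /= /v /u /centered_truncate -/mu opprB addrA addrAC.
    + by apply: integrable_addr => //; exact: integrable_cst_fun.
    move=> w _; apply: le_trans (ler_normD _ _); rewrite le_eqVlt; apply/orP; left.
    by apply/eqP; congr `|_|; rewrite /v /u /centered_truncate -/mu; ring.
  rewrite RintegralD//=; last exact: integrable_cst_fun.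
  by rewrite Rintegral_cstT; lra.
Qed.

End truncation.

(** * Sums of products in the volatility model *)

Section volatility_model.
Context (R : realType) (d : measure_display) (T : measurableType d).
Variable P : probability T R.
Local Notation L1 f := (P.-integrable setT (EFin \o f)).
Variables (Z sigma : nat * nat -> T -> R).
Hypothesis mZ : forall k, measurable_fun setT (Z k).
Hypothesis indepZ : mutually_independent P Z.
Hypothesis identZ : identically_distributed P Z.
Hypothesis msigma : forall k, measurable_fun setT (sigma k).
Hypothesis sigma_ge0 : forall k w, 0 <= sigma k w.
Hypothesis indepZsigma : independent_families P Z sigma.
Variable M : R.
Hypothesis sigma4 : forall k, L1 (fun w => sigma k w ^+ 4) /\
  \int[P]_w (sigma k w ^+ 4) <= M.

(** Independence from the noise is known on the sigma-algebra generated by the volatilities, so the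
    weights must be measurable for that one. *)
Definition volatility_measurable (S : T -> R) : Prop :=
  @measurable_fun _ _ (g_sigma_algebraType (generators sigma)) R setT S.

Lemma volatility_measurable_sigma k : volatility_measurable (sigma k).
Proof.
move=> _ B mB; rewrite setTI.
by apply: (@sub_sigma_algebra _ setT (generators sigma)); exists k => //; exists B.
Qed.

Lemma volatility_measurableM S S' : volatility_measurable S ->
  volatility_measurable S' -> volatility_measurable (fun w => S w * S' w).
Proof. exact: measurable_funM. Qed.

Lemma volatility_measurable_powR S (beta : R) : volatility_measurable S ->
  volatility_measurable (fun w => S w `^ beta).
Proof. by move=> mS; apply: (measurableT_comp (measurable_powR beta)). Qed.

Lemma volatility_factors s S : volatility_measurable S ->
  measurable_fun setT S -> (forall w, 0 <= S w) -> uniq s -> factors P Z s S.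
Proof.
move=> gS mS S0 us; apply: factors_of_indep => // A B gA mB.
by apply: indepZsigma => //; have := gS measurableT _ mB; rewrite setTI.
Qed.

(** One constant, 2 + 2M, serves all weights below. For a product S of two volatilities and beta <=
    1, each of S, S^2 and S^beta <= 1 + S is below the stated majorant. *)
Lemma sigma_pair_bound (k l : nat * nat) (S : T -> R) : measurable_fun setT S ->
  (forall w, 0 <= S w <= 2 + sigma k w ^+ 4 + sigma l w ^+ 4) ->
  L1 S /\ \int[P]_w S w <= 2 + 2 * M.
Proof.
move=> mS S0.
have [ik bk] := sigma4 k; have [il bl] := sigma4 l.
have i2 : L1 (fun w => 2 + sigma k w ^+ 4).
  by apply: integrable_addr => //; exact: integrable_cst_fun.
have i3 : L1 (fun w => 2 + sigma k w ^+ 4 + sigma l w ^+ 4) by exact: integrable_addr.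
have iS : L1 S.
  by apply: (integrable_dominated _ _ _ _ S _ mS i3) => w; case/andP: (S0 w) => ? ?;
     rewrite ger0_norm.
split => //; apply: (@le_trans _ _ (\int[P]_w (2 + sigma k w ^+ 4 + sigma l w ^+ 4))).
  by apply: le_Rintegral => // w _; case/andP: (S0 w).
rewrite RintegralD//= RintegralD//=; last exact: integrable_cst_fun.
by rewrite Rintegral_cstT; lra.
Qed.

Local Notation X k := (fun w => sigma k w * Z k w).
Local Notation S i j t := (fun w => sigma (i, t : nat) w * sigma (j, t : nat) w).

Lemma measurable_sigma_pair i j t : measurable_fun setT (S i j t).
Proof. exact: measurable_funM. Qed.

Lemma volatility_measurable_sigma_pair i j t : volatility_measurable (S i j t).
Proof. by apply: volatility_measurableM; exact: volatility_measurable_sigma. Qed.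

Lemma sum_products_prob_powR_le (beta m r : R) (i j n : nat) : i != j ->
  0 < beta <= 1 -> L1 (fun w => `|Z (0, 0)%N w| `^ beta) ->
  \int[P]_w (`|Z (0, 0)%N w| `^ beta) = m -> 0 < r ->
  Pr P [set w | r < `|\sum_(t < n) X (i, nat_of_ord t) w * X (j, nat_of_ord t) w|] <=
  n%:R * ((2 + 2 * M) * m * m) / r `^ beta.
Proof.
move=> ij b01 iZ Em r0; have /andP[b0 b1] := b01.
pose g (x : R) := `|x| `^ beta.
have mg : measurable_fun setT g.
  exact: (measurableT_comp (measurable_powR beta) (@normr_measurable _ setT)).
have g0 x : 0 <= g x by exact: powR_ge0.
have gZ k : L1 (fun w => g (Z k w)) /\ \int[P]_w g (Z k w) = m.
  by rewrite -Em; apply: ge0_integrable_ident => // B mB; exact: identZ.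
pose Sb (t : nat) w := (S i j t w) `^ beta.
have S0 t w : 0 <= S i j t w by rewrite mulr_ge0.
have mSb t : measurable_fun setT (Sb t).
  by apply: (measurableT_comp (measurable_powR beta)); exact: measurable_sigma_pair.
have Sb0 t w : 0 <= Sb t w by exact: powR_ge0.
have [iSb bSb] : (forall t, L1 (Sb t)) /\ (forall t, \int[P]_w Sb t w <= 2 + 2 * M).
  apply/all_and2 => t; apply: (sigma_pair_bound (i, t) (j, t)) => // w.
  rewrite Sb0/=; have := mulr_le_pow4 _ (sigma (i, t) w) (sigma (j, t) w).
  suff : Sb t w <= 1 + S i j t w by move=> /= *; lra.
  by apply: powR_le_1D; rewrite // ltW.
pose F t w := Sb t w * g (Z (i, t) w) * g (Z (j, t) w).
have [iF eF] : (forall t, L1 (F t)) /\ (forall t, \int[P]_w F t w <= (2 + 2 * M) * m * m).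
  apply/all_and2 => t.
  have nij : (i, t) != (j, t) by rewrite xpair_eqE negb_and ij.
  have fS : factors P Z [:: (i, t); (j, t)] (Sb t).
    apply: volatility_factors => //; last by rewrite /= inE nij.
    by apply: volatility_measurable_powR; exact: volatility_measurable_sigma_pair.
  have [iFt ->] := factors_mul2R _ _ _ P _ Z _ _ _ _ _ mZ nij (Sb0 t) (iSb t) fS
     mg g0 (gZ (i, t)).1 mg g0 (gZ (j, t)).1.
  split => //; rewrite !(gZ _).2.
  have m0 : 0 <= m by rewrite -Em; apply: Rintegral_ge0 => w _; exact: powR_ge0.
  by rewrite !ler_wpM2r.
have [iSum eSum] := Rintegral_sumr _ _ _ P _ (index_enum 'I_n) (fun t => F (nat_of_ord t))
   (fun t => iF _).
have mX k : measurable_fun setT (X k) by exact: measurable_funM.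
apply: (@le_trans _ _ ((\int[P]_w \sum_(t < n) F t w) / r `^ beta)).
  apply: Pr_le_expectation => //.
  - apply: measurable_norm_gt; apply: measurable_sum => t; exact: measurable_funM.
  - by move=> w; apply: sumr_ge0 => t _; rewrite !mulr_ge0.
  - by rewrite powR_gt0.
  move=> w /= /ltW rw.
  apply: (@le_trans _ _ (`|\sum_(t < n) X (i, nat_of_ord t) w * X (j, nat_of_ord t) w| `^ beta)).
    by rewrite ge0_ler_powR ?nnegrE// ltW.
  apply: le_trans (powR_sum_le _ _ _ _ _ b01) _.
  apply: ler_sum => t _; rewrite le_eqVlt; apply/orP; left; apply/eqP.
  rewrite /F /Sb /g -!powRM ?mulr_ge0//; congr (_ `^ _).
  by rewrite !normrM !(ger0_norm (sigma_ge0 _ _)); ring.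
rewrite ler_pM2r ?invr_gt0 ?powR_gt0// eSum.
apply: (@le_trans _ _ (\sum_(t < n) ((2 + 2 * M) * m * m))).
  by apply: ler_sum => t _; exact: eF.
by rewrite sumr_const card_ord [leRHS]mulr_natl.
Qed.

(** The square is expanded into a double sum over s and t. For s <> t the four noise indices are
    distinct, as i <> j, and the term vanishes; for s = t it factors into a weight and V^2. The
    bound [c] on [u] serves integrability and does not enter the estimate. *)
Lemma centered_sum_second_moment (u : R -> R) (c V : R) (i j n : nat) : i != j ->
  measurable_fun setT u -> (forall x, `|u x| <= c) ->
  \int[P]_w u (Z (0, 0)%N w) = 0 -> \int[P]_w (u (Z (0, 0)%N w) ^+ 2) = V ->
  L1 (fun w => (\sum_(t < n) S i j t w * u (Z (i, nat_of_ord t) w) *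
    u (Z (j, nat_of_ord t) w)) ^+ 2) /\
  \int[P]_w ((\sum_(t < n) S i j t w * u (Z (i, nat_of_ord t) w) * u (Z (j, nat_of_ord t) w)) ^+ 2)
    <= n%:R * ((2 + 2 * M) * V * V).
Proof.
move=> ij mu uc u0 EV.
pose g (x : R) := u x ^+ 2.
have mg : measurable_fun setT g by exact: measurable_funX.
have g0 x : 0 <= g x by exact: sqr_ge0.
have c0 : 0 <= c by rewrite (le_trans _ (uc 0)).
have gc x : `|g x| <= c ^+ 2.
  by rewrite ger0_norm// /g -(real_normK (num_real _)) lerXn2r ?nnegrE.
have muZ k : measurable_fun setT (fun w => u (Z k w)) by exact: measurableT_comp.
have gZ k : L1 (fun w => g (Z k w)) /\ \int[P]_w g (Z k w) = V.
  rewrite -EV; apply: ge0_integrable_ident => //; first by move=> B mB; exact: identZ.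
  by apply: (integrable_bounded _ _ _ _ _ (c ^+ 2)) => //; exact: measurableT_comp.
have uZ k : \int[P]_w u (Z k w) = 0.
  rewrite -u0; apply: (bounded_Rintegral_ident _ _ _ _ _ _ _ c) => // B mB.
  exact: identZ.
have S0 t w : 0 <= S i j t w by rewrite mulr_ge0.
have mS t : measurable_fun setT (S i j t) by exact: measurable_sigma_pair.
pose SS s t w := S i j s w * S i j t w.
have SS0 s t w : 0 <= SS s t w by rewrite mulr_ge0.
have mSS s t : measurable_fun setT (SS s t) by exact: measurable_funM.
have vSS s t : volatility_measurable (SS s t).
  by apply: volatility_measurableM; exact: volatility_measurable_sigma_pair.
have i4 k : L1 (fun w => sigma k w ^+ 4) := (sigma4 k).1.
(* A product xy is at most x^2 + y^2 in modulus, and the square of each pair weight is at most a sum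
   of two fourth powers. *)
have iSS s t : L1 (SS s t).
  apply: (integrable_dominated _ _ _ _ _ (fun w => sigma (i, s) w ^+ 4 + sigma (j, s) w ^+ 4 +
     (sigma (i, t) w ^+ 4 + sigma (j, t) w ^+ 4)) (mSS s t)).
    by do ?apply: integrable_addr; exact: i4.
  move=> w; rewrite ger0_norm//; have := sqr_mulr_le_pow4 _ (sigma (i, s) w) (sigma (j, s) w).
  have := sqr_mulr_le_pow4 _ (sigma (i, t) w) (sigma (j, t) w).
  rewrite /SS; move: (S i j s w) (S i j t w) => /= x y; have := sqr_ge0 (x - y).
  have := sqr_ge0 (x + y); nra.
pose F s t w := SS s t w * u (Z (i, s) w) * u (Z (j, s) w) * u (Z (i, t) w) * u (Z (j, t) w).
have iF s t : L1 (F s t).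
  by do ?[apply: (integrable_mul_bounded _ _ _ _ _ _ c) => //].
have off s t : s != t -> \int[P]_w F s t w = 0.
  move=> st.
  have us : uniq [:: (i, s); (j, s); (i, t); (j, t)].
    by rewrite /= !inE !xpair_eqE !eqxx (negbTE ij) (negbTE st) eq_sym (negbTE ij) !andbF.
  have fS := volatility_factors _ _ (vSS s t) (mSS s t) (SS0 s t) us.
  exact: (centered_product_orthogonal _ _ _ P _ Z _ _ _ _ _ u c mZ us (SS0 s t) (iSS s t) fS).
have diag t : \int[P]_w F t t w <= (2 + 2 * M) * V * V.
  have nij : (i, t) != (j, t) by rewrite xpair_eqE negb_and ij.
  have fS : factors P Z [:: (i, t); (j, t)] (SS t t).
    by apply: volatility_factors => //; rewrite /= inE nij.
  have [_ e] := factors_mul2R _ _ _ P _ Z _ _ _ _ _ mZ nij (SS0 t t) (iSS t t) fS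
     mg g0 (gZ (i, t)).1 mg g0 (gZ (j, t)).1.
  have -> : \int[P]_w F t t w = \int[P]_w (SS t t w * g (Z (i, t) w) * g (Z (j, t) w)).
    by apply: eq_Rintegral => w _; rewrite /F /g; ring.
  rewrite e !(gZ _).2.
  have V0 : 0 <= V by rewrite -EV; apply: Rintegral_ge0 => w _; exact: sqr_ge0.
  rewrite !ler_wpM2r//; apply: (sigma_pair_bound (i, t) (j, t) _ _ _).2 => // w.
  rewrite SS0/= /SS -expr2; have := sqr_mulr_le_pow4 _ (sigma (i, t) w) (sigma (j, t) w).
  by move: (_ ^+ 2) => q; lra.
have E : (fun w => (\sum_(t < n) S i j t w * u (Z (i, nat_of_ord t) w) *
    u (Z (j, nat_of_ord t) w)) ^+ 2) = (fun w => \sum_(s < n) \sum_(t < n) F s t w).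
  apply/funext => w; rewrite expr2 big_distrl/=; apply: eq_bigr => s _.
  by rewrite big_distrr/=; apply: eq_bigr => t _; rewrite /F /SS; ring.
have inner (s : nat) := Rintegral_sumr _ _ _ P _ (index_enum 'I_n) (fun t => F s (nat_of_ord t))
   (fun t => iF _ _).
have [iSum eSum] := Rintegral_sumr _ _ _ P _ (index_enum 'I_n)
   (fun s w => \sum_(t < n) F (nat_of_ord s) t w) (fun s => (inner s).1).
rewrite E; split => //; rewrite eSum.
apply: (@le_trans _ _ (\sum_(t < n) ((2 + 2 * M) * V * V))); last first.
  by rewrite sumr_const card_ord [leRHS]mulr_natl.
apply: ler_sum => s _; rewrite (inner s).2 (bigD1 s)//= [Y in _ + Y]big1 ?addr0//.
by move=> t ts; apply: off; rewrite eq_sym.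
Qed.

Lemma sum_products_prob_truncated_le (u : R -> R) (c V A B D r : R) (i j n : nat) : i != j ->
  measurable_fun setT u -> (forall x, `|u x| <= c) -> L1 (Z (0, 0)%N) ->
  \int[P]_w u (Z (0, 0)%N w) = 0 -> \int[P]_w (u (Z (0, 0)%N w) ^+ 2) = V ->
  \int[P]_w `|u (Z (0, 0)%N w)| = A ->
  \int[P]_w `|Z (0, 0)%N w - u (Z (0, 0)%N w)| = B ->
  \int[P]_w `|Z (0, 0)%N w| = D -> 0 < r ->
  Pr P [set w | r < `|\sum_(t < n) X (i, nat_of_ord t) w * X (j, nat_of_ord t) w|] <=
  n%:R * ((2 + 2 * M) * V * V / (r / 2) ^+ 2 + (2 + 2 * M) * (A * B + B * D) / (r / 2)).
Proof.
move=> ij mu uc iZ u0 EV EA EB ED r0.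
have r2 : 0 < r / 2 by lra.
pose v (x : R) := x - u x.
have mv : measurable_fun setT v by exact: measurable_funB.
have iu : L1 (fun w => u (Z (0, 0)%N w)).
  by apply: (integrable_bounded _ _ _ _ _ c) => //; exact: measurableT_comp.
have iv : L1 (fun w => v (Z (0, 0)%N w)).
  have := integrable_addr _ _ _ _ _ _ iZ (integrable_mulr _ _ _ _ _ (-1) iu).
  by apply: eq_integrable => // w _; rewrite /= /v mulN1r.
have nrm (g : R -> R) a : measurable_fun setT g -> L1 (fun w => g (Z (0, 0)%N w)) ->
    \int[P]_w `|g (Z (0, 0)%N w)| = a ->
    forall k, L1 (fun w => `|g (Z k w)|) /\ \int[P]_w `|g (Z k w)| = a.
  move=> mg ig <- k; apply: (ge0_integrable_ident _ _ _ _ _ _ (fun x => `|g x|)) => //.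
  - by move=> B' mB; exact: identZ.
  - exact: measurableT_comp.
  - exact: integrable_norm ig.
have hu := nrm u A mu iu EA; have hv := nrm v B mv iv EB.
have hz := nrm id D (@measurable_id _ _ _) iZ ED.
have S0 t w : 0 <= S i j t w by rewrite mulr_ge0.
have mS t : measurable_fun setT (S i j t) by exact: measurable_sigma_pair.
have [iS bS] : (forall t, L1 (S i j t)) /\ (forall t, \int[P]_w S i j t w <= 2 + 2 * M).
  apply/all_and2 => t; apply: (sigma_pair_bound (i, t) (j, t)) => // w.
  rewrite S0/=; have := mulr_le_pow4 _ (sigma (i, t) w) (sigma (j, t) w).
  by move=> h; lra.
have N0 : 0 <= 2 + 2 * M by apply: le_trans (bS 0%N); apply: Rintegral_ge0 => w _; exact: S0.
(* A majorant of the terms of [Y2] below, where no cancellation is used. *)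
pose G t w := S i j t w * `|u (Z (i, t) w)| * `|v (Z (j, t) w)| +
              S i j t w * `|v (Z (i, t) w)| * `|Z (j, t) w|.
have [iG bG] : (forall t, L1 (G t)) /\
    (forall t, \int[P]_w G t w <= (2 + 2 * M) * (A * B + B * D)).
  apply/all_and2 => t.
  have nij : (i, t) != (j, t) by rewrite xpair_eqE negb_and ij.
  have fS : factors P Z [:: (i, t); (j, t)] (S i j t).
    apply: volatility_factors => //; last by rewrite /= inE nij.
    exact: volatility_measurable_sigma_pair.
  have mn (g : R -> R) : measurable_fun setT g -> measurable_fun setT (fun x => `|g x|).
    by move=> mg; exact: measurableT_comp.
  have [i1 e1] := factors_mul2R _ _ _ P _ Z _ _ _ (fun x => `|u x|) (fun x => `|v x|)
     mZ nij (S0 t) (iS t) fS (mn _ mu) (fun=> normr_ge0 _) (hu (i, t)).1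
     (mn _ mv) (fun=> normr_ge0 _) (hv (j, t)).1.
  have [i2 e2] := factors_mul2R _ _ _ P _ Z _ _ _ (fun x => `|v x|) (fun x => `|x|)
     mZ nij (S0 t) (iS t) fS (mn _ mv) (fun=> normr_ge0 _) (hv (i, t)).1
     (mn _ (@measurable_id _ _ _)) (fun=> normr_ge0 _) (hz (j, t)).1.
  split; first exact: integrable_addr.
  rewrite /G RintegralD//= e1 e2 (hu _).2 !(hv _).2 (hz _).2.
  have A0 : 0 <= A by rewrite -EA; apply: Rintegral_ge0 => w _; exact: normr_ge0.
  have B0 : 0 <= B by rewrite -EB; apply: Rintegral_ge0 => w _; exact: normr_ge0.
  have D0 : 0 <= D by rewrite -ED; apply: Rintegral_ge0 => w _; exact: normr_ge0.
  by rewrite -!mulrA -mulrDr ler_wpM2r// addr_ge0 ?mulr_ge0.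
pose Y1 w := \sum_(t < n) S i j t w * u (Z (i, nat_of_ord t) w) * u (Z (j, nat_of_ord t) w).
pose Y2 w := \sum_(t < n) (S i j t w * u (Z (i, nat_of_ord t) w) * v (Z (j, nat_of_ord t) w)
  + S i j t w * v (Z (i, nat_of_ord t) w) * Z (j, nat_of_ord t) w).
have mgZ (g : R -> R) k : measurable_fun setT g -> measurable_fun setT (fun w => g (Z k w)).
  by move=> mg; exact: measurableT_comp.
have mY1 : measurable_fun setT Y1.
  apply: measurable_sum => t; apply: measurable_funM; last exact: mgZ.
  by apply: measurable_funM => //; exact: mgZ.
have mY2 : measurable_fun setT Y2.
  apply: measurable_sum => t; apply: measurable_funD.
    by apply: measurable_funM; [apply: measurable_funM => //; exact: mgZ|exact: mgZ].
  by apply: measurable_funM; [apply: measurable_funM => //; exact: mgZ|].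
have E w : \sum_(t < n) X (i, nat_of_ord t) w * X (j, nat_of_ord t) w = Y1 w + Y2 w.
  by rewrite /Y1 /Y2 -big_split/=; apply: eq_bigr => t _; rewrite /v; ring.
(* The orthogonal part [Y1] and the remainder [Y2] each receive half of the threshold. *)
apply: (@le_trans _ _ (Pr P [set w | r / 2 < `|Y1 w|] + Pr P [set w | r / 2 < `|Y2 w|])).
  apply: le_trans (PrU _ _ _ P _ _ _ _); [|exact: measurable_norm_gt..].
  apply: le_Pr.
  - rewrite (_ : [set w | _] = [set w | r < `|Y1 w + Y2 w|]).
      by apply: measurable_norm_gt; exact: measurable_funD.
    by apply/seteqP; split=> w /=; rewrite E.
  - by apply: measurableU; exact: measurable_norm_gt.
  move=> w /=; rewrite E => rY.
  have [Y1r|Y1r] := ltP (r / 2) `|Y1 w|; [by left|right].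
  by have := le_lt_trans Y1r; have := ler_normD (Y1 w) (Y2 w) => *; lra.
rewrite mulrDr lerD//.
  have [iY1 bY1] := centered_sum_second_moment _ _ _ _ _ n ij mu uc u0 EV.
  apply: (@le_trans _ _ ((\int[P]_w (Y1 w ^+ 2)) / (r / 2) ^+ 2)).
    apply: Pr_le_expectation => //.
    - exact: measurable_norm_gt.
    - by move=> w; exact: sqr_ge0.
    - by rewrite exprn_gt0.
    move=> w /= /ltW h; rewrite -[leRHS](real_normK (num_real _)).
    by rewrite lerXn2r// nnegrE ltW.
  by rewrite mulrA ler_pM2r// invr_gt0 exprn_gt0.
have [iSum eSum] := Rintegral_sumr _ _ _ P _ (index_enum 'I_n) (fun t => G (nat_of_ord t))
   (fun t => iG _).
apply: (@le_trans _ _ ((\int[P]_w \sum_(t < n) G t w) / (r / 2))).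
  apply: Pr_le_expectation => //.
  - exact: measurable_norm_gt.
  - by move=> w; apply: sumr_ge0 => t _; rewrite addr_ge0// !mulr_ge0.
  move=> w /= /ltW h; apply: (le_trans h); apply: le_trans (ler_norm_sum _ _ _) _.
  apply: ler_sum => t _; apply: le_trans (ler_normD _ _) _.
  by rewrite /G !normrM !(ger0_norm (sigma_ge0 _ _)).
rewrite mulrA ler_pM2r ?invr_gt0// eSum.
apply: (@le_trans _ _ (\sum_(t < n) ((2 + 2 * M) * (A * B + B * D)))).
  by apply: ler_sum => t _; exact: bG.
by rewrite sumr_const card_ord [leRHS]mulr_natl.
Qed.

(** * Convergence of the normalized products *)

Section normalized_products.
Variables (alpha : R) (a : nat -> R).
Hypothesis Zrv : regularly_varying P (Z (0, 0)%N) alpha.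
Hypothesis ha : (fun n => n%:R * tail P (X (0, 0)%N) (a n)) @ \oo --> (1 : R).

Lemma measurable_product k : measurable_fun setT (X k).
Proof. exact: measurable_funM. Qed.

(** Follows from the normalization itself: if the volatility were almost surely 0, then n P(|X| >
    a_n) would be 0 for a_n >= 0 and n for a_n < 0, so it could not tend to 1. *)
Lemma volatility_positive : exists2 s, 0 < s & 0 < Pr P [set w | s < sigma (0, 0)%N w].
Proof.
have mX := measurable_product (0, 0)%N.
have ms s : measurable [set w | s < sigma (0, 0)%N w] by exact: measurable_gt.
apply: contrapT => nex.
have s0 s : 0 < s -> P [set w | s < sigma (0, 0)%N w] = 0%E.
  move=> s0; rewrite -EFin_Pr//; congr EFin; apply/eqP; rewrite eq_le Pr_ge0 andbT leNgt.
  by apply/negP => h; apply: nex; exists s.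
have pos0 : P [set w | 0 < sigma (0, 0)%N w] = 0%E.
  apply/(@measure_negligible _ _ _ P) => //.
  rewrite (_ : [set w | _] = \bigcup_k [set w | k.+1%:R^-1 < sigma (0, 0)%N w]).
    apply: negligible_bigcup => k; apply/negligibleP => //.
    by apply: s0; rewrite invr_gt0.
  apply/seteqP; split=> w /=; last first.
    by move=> [k _ /=]; apply: lt_trans; rewrite invr_gt0.
  move=> sw; exists (Num.truncn (sigma (0, 0)%N w)^-1) => //=.
  rewrite invf_plt ?posrE//; apply: truncnS_gt; exact: num_real.
have h1 : \forall n \near \oo, n%:R * tail P (X (0, 0)%N) (a n) < 2.
  by apply: (cvgr_lt _ ha); rewrite ltr1n.
have h2 : \forall n \near \oo, 0 < n%:R * tail P (X (0, 0)%N) (a n).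
  exact: (cvgr_gt _ ha).
(* With n >= 2, a negative [a n] makes n P(|X| > a_n) at least 2, against [h1]. *)
have h3 : \forall n \near \oo, (2 <= n)%N by exists 2%N.
move: h1 => /(filterI h2)/(filterI h3)/filter_ex [n [n2 [hpos hlt]]].
have n2R : 2 <= n%:R :> R by rewrite ler_nat.
have [an|an] := leP 0 (a n).
  have : tail P (X (0, 0)%N) (a n) <= Pr P [set w | 0 < sigma (0, 0)%N w].
    apply: le_Pr => //; first exact: measurable_norm_gt.
    move=> w /= h; have : 0 < `|sigma (0, 0)%N w * Z (0, 0)%N w| by exact: le_lt_trans h.
    rewrite normr_gt0 mulf_eq0 negb_or => /andP[h' _].
    by rewrite lt0r h' sigma_ge0.
  have -> : Pr P [set w | 0 < sigma (0, 0)%N w] = 0 by rewrite /Pr pos0.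
  move=> t0; move: hpos; rewrite pmulr_rgt0; last by lra.
  by rewrite ltNge t0.
have : tail P (X (0, 0)%N) (a n) = 1.
  rewrite /tail (_ : [set w | _] = setT) ?/Pr ?probability_setT//.
  by apply/seteqP; split=> // w _ /=; exact: lt_le_trans an _.
by move=> t1; move: hlt; rewrite t1 mulr1; lra.
Qed.

(** If sigma > s and |Z| > x/s then |X| > x. By independence the tail of X at x is at least P(sigma
    > s) times the tail of Z at x/s, and a lower bound is all that divergence asks for. *)
Lemma tail_product_cvgy gamma : alpha < gamma ->
  (fun x => x `^ gamma * tail P (X (0, 0)%N) x) @ +oo --> +oo.
Proof.
have [s s0 ps] := volatility_positive.
have mX := measurable_product (0, 0)%N.
have [Hpos Hr] := regularly_varying_tail _ _ _ P _ _ (mZ (0, 0)%N) Zrv.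
have anti x y : x <= y -> tail P (Z (0, 0)%N) y <= tail P (Z (0, 0)%N) x.
  by move=> xy; exact: tail_anti.
have Zy g : alpha < g -> (fun x => x `^ g * tail P (Z (0, 0)%N) x) @ +oo --> +oo.
  move=> ag; apply: (dyadic_tail_cvgy _ _ _ _ anti Hpos Hr _ ag).
  by move=> x; exact: Pr_ge0.
apply: (scaled_tail_cvgy _ _ _ Zy _ _ _ ps s0).
move=> x x0.
have ms : measurable [set w | s < sigma (0, 0)%N w] by exact: measurable_gt.
have mz : measurable [set w | x / s < `|Z (0, 0)%N w|] by exact: measurable_norm_gt.
have e : P ([set w | x / s < `|Z (0, 0)%N w|] `&` [set w | s < sigma (0, 0)%N w]) =
    (P [set w | (x / s < `|Z (0, 0)%N w|)%R] * P [set w | (s < sigma (0, 0)%N w)%R])%E.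
  apply: indepZsigma.
    apply: (@sub_sigma_algebra _ setT (generators Z)).
    exists (0, 0)%N => //; exists [set z : R | x / s < `|z|] => //=.
    by apply: measurable_gt; exact: normr_measurable.
  apply: (@sub_sigma_algebra _ setT (generators sigma)).
  exists (0, 0)%N => //; exists [set z : R | s < z] => //=.
  by apply: measurable_gt; exact: measurable_id.
have -> : Pr P [set w | s < sigma (0, 0)%N w] * tail P (Z (0, 0)%N) (x / s) =
    Pr P ([set w | x / s < `|Z (0, 0)%N w|] `&` [set w | s < sigma (0, 0)%N w]).
  apply: EFin_inj; rewrite EFin_Pr; last exact: measurableI.
  by rewrite EFinM e muleC !EFin_Pr.
apply: le_Pr; [exact: measurableI|exact: measurable_norm_gt|].
move=> w /= [hz hs]; rewrite normrM (ger0_norm (sigma_ge0 _ _)).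
rewrite ltr_pdivrMr// mulrC in hz; apply: (lt_le_trans hz).
by rewrite ler_wpM2r// ltW.
Qed.

Lemma normalizer_cvgy : a @ \oo --> +oo.
Proof.
apply: (normalizing_cvgy _ (tail P (X (0, 0)%N)) _ _ _ tail_product_cvgy ha).
by move=> x y xy; apply: tail_anti => //; exact: measurable_product.
Qed.

(** Origin of the exponents. For alpha < 2, b = alpha - alpha^2/4 gives 1 - b = (1 - alpha/2)^2 and
    2b - alpha = alpha (2 - alpha)/2. For alpha >= 2, b is chosen to make 4b - 4 the midpoint of
    alpha and 4; then 2b = 3 + alpha/4, which exceeds alpha below 4. *)
Lemma normalized_product_cvg (i j : nat) (e : R) : 0 < alpha < 4 ->
  (L1 (Z (0, 0)%N) -> \int[P]_w Z (0, 0)%N w = 0) -> i != j -> 0 < e ->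
  (fun n => Pr P [set w | e * a n ^+ 2 <
     `|\sum_(t < n) X (i, nat_of_ord t) w * X (j, nat_of_ord t) w| ]) @ \oo --> (0 : R).
Proof.
move=> /andP[a0 a4] cZ ij e0.
have mX := measurable_product (0, 0)%N.
have anti x y : x <= y -> tail P (X (0, 0)%N) y <= tail P (X (0, 0)%N) x.
  by move=> xy; exact: tail_anti.
have acvg := normalizer_cvgy.
have rate := normalizing_rate _ _ _ _ anti tail_product_cvgy ha.
have a1 : \forall n \near \oo, 1 <= a n by move/cvgryPge : acvg; apply.
have mom (b : R) : 0 < b < alpha -> L1 (fun w => `|Z (0, 0)%N w| `^ b).
  move=> hb; apply: ge0_integrable_lty.
  - apply: (measurableT_comp (measurable_powR b)); exact: measurableT_comp.
  - by move=> w; exact: powR_ge0.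
  - exact: regularly_varying_moment Zrv hb.
have [al2|al2] := ltP alpha 2.
  (* chosen so that [b <= 1] and [b < alpha < 2 b] *)
  pose b := alpha - alpha ^+ 2 / 4.
  have b01 : 0 < b <= 1 by rewrite /b; apply/andP; split; [nra|have := sqr_ge0 (alpha - 2); nra].
  have ba : 0 < b < alpha by rewrite (andP b01).1 /b /=; nra.
  have ab : alpha < 2 * b by rewrite /b; nra.
  pose m := \int[P]_w (`|Z (0, 0)%N w| `^ b).
  pose C := (2 + 2 * M) * m * m * e `^ (- b).
  apply: (@squeeze_cvgr _ _ _ _ (cst 0) (fun n => C * (n%:R * a n `^ (- (2 * b))))).
  - move: a1; apply: filterS => n a1.
    rewrite Pr_ge0/=; have r0 : 0 < e * a n ^+ 2 by rewrite mulr_gt0// exprn_gt0//; lra.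
    apply: le_trans (sum_products_prob_powR_le b m _ _ _ n ij b01 (mom _ ba) erefl r0) _.
    rewrite le_eqVlt; apply/orP; left; apply/eqP.
    have an0 : 0 <= a n by lra.
    rewrite powRM ?(ltW e0) ?sqr_ge0// -powR_mulrn// -powRrM invfM -!powRN /C.
    by ring.
  - exact: cvg_cst.
  - rewrite -[Y in _ --> Y](mulr0 C); apply: cvgM; first exact: cvg_cst.
    exact: rate.
(* chosen so that [b <= 2], [b < alpha < 2 b] and [alpha < 4 b - 4]; [Z] is
   truncated at the level [a n ^+ 2] *)
pose b := 1 + (alpha + 4) / 8.
have b12 : 1 <= b <= 2 by rewrite /b; apply/andP; split; lra.
have ba : 0 < b < alpha by rewrite /b; apply/andP; split; lra.
have iB := mom _ ba.
have iZ : L1 (Z (0, 0)%N).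
  apply: (integrable_dominated _ _ _ _ _ (fun w => 1 + `|Z (0, 0)%N w| `^ b)) => //.
    by apply: integrable_addr => //; exact: integrable_cst_fun.
  by move=> w; apply: le_1D_powR => //; case/andP: b12.
have Z0 := cZ iZ.
pose m := \int[P]_w (`|Z (0, 0)%N w| `^ b).
have m0 : 0 <= m by apply: Rintegral_ge0 => w _; exact: powR_ge0.
have N0 : 0 <= 2 + 2 * M.
  have := (sigma4 (0, 0)%N).2; have : 0 <= \int[P]_w (sigma (0, 0)%N w ^+ 4).
    by apply: Rintegral_ge0 => w _; rewrite exprn_ge0.
  by lra.
pose K := 2 * m + 2 * (1 + m) ^+ 2.
(* The factors 4 here and 2 in [C2] come from the halved threshold; the 6 in [C2] is 4 from [A * B]
   plus 2 from [B * D]. *)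
pose C1 := (2 + 2 * M) * K * K * 4 / e ^+ 2.
pose C2 := (2 + 2 * M) * (6 * m * (1 + m)) * 2 / e.
apply: (@squeeze_cvgr _ _ _ _ (cst 0) (fun n => C1 * (n%:R * a n `^ (- (4 * b - 4))) +
   C2 * (n%:R * a n `^ (- (2 * b))))).
- move: a1; apply: filterS => n a1.
  have an0 : 0 < a n by lra.
  have c1 : 1 <= a n ^+ 2 by rewrite exprn_ege1.
  rewrite Pr_ge0/=; have r0 : 0 < e * a n ^+ 2 by rewrite mulr_gt0// exprn_gt0.
  pose u := centered_truncate _ _ _ P (Z (0, 0)%N) (a n ^+ 2).
  have [[ub u0 bV bA bB] bD] :=
    centered_truncation_bounds _ _ _ P _ _ _ _ iZ Z0 b12 c1 iB erefl.
  rewrite -/u in ub u0 bV bA bB.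
  have mu : measurable_fun setT u.
    have mt : measurable_fun setT (truncate R (a n ^+ 2)) by exact: measurable_truncate.
    by apply: measurable_funB.
  apply: le_trans (sum_products_prob_truncated_le u _ _ _ _ _ _ _ _ n ij mu ub iZ u0
    erefl erefl erefl erefl r0) _.
  set V := \int[P]_w (u _ ^+ 2) in bV *.
  set A := \int[P]_w `|u _| in bA *.
  set B := \int[P]_w `|_ - u _| in bB *.
  set D := \int[P]_w `|Z _ _| in bD *.
  have V0 : 0 <= V by apply: Rintegral_ge0 => w _; exact: sqr_ge0.
  have A0 : 0 <= A by apply: Rintegral_ge0 => w _; exact: normr_ge0.
  have B0 : 0 <= B by apply: Rintegral_ge0 => w _; exact: normr_ge0.
  have D0 : 0 <= D by apply: Rintegral_ge0 => w _; exact: normr_ge0.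
  pose x := (a n ^+ 2) `^ (2 - b); pose y := (a n ^+ 2) `^ (1 - b).
  have y0 : 0 <= y by exact: powR_ge0.
  (* The squared variance bound over a_n^4 and the remainder bound over a_n^2 become single powers
     of a_n, to which [rate] applies. *)
  have xE : a n `^ (- (4 * b - 4)) = x * x / (a n ^+ 2) ^+ 2.
    rewrite /x -!powR_mulrn ?(ltW an0) ?powR_ge0// -!powRrM -powRN -!powRD ?(gt_eqF an0) ?implybT//.
    by congr (_ `^ _); ring.
  have yE : a n `^ (- (2 * b)) = y / (a n ^+ 2).
    rewrite /y -!powR_mulrn ?(ltW an0)// -!powRrM -powRN -!powRD ?(gt_eqF an0) ?implybT//.
    by congr (_ `^ _); ring.
  rewrite -/x -/y -/K -/m in bV bB bA bD.
  have VV : V * V <= (K * x) * (K * x) by rewrite ler_pM.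
  have AB : A * B + B * D <= 6 * m * (1 + m) * y.
    have h1 : A * B <= (2 * (1 + m)) * (2 * m * y) by rewrite ler_pM.
    have h2 : B * D <= (2 * m * y) * (1 + m) by rewrite ler_pM.
    by lra.
  rewrite (mulrCA C1) (mulrCA C2) -mulrDr ler_wpM2l// xE yE.
  have s0 : 0 < a n ^+ 2 by rewrite exprn_gt0.
  move: (a n ^+ 2) s0 r0 {xE yE c1 ub u0} => q q0 r0.
  apply: lerD.
    rewrite (_ : C1 * _ = (2 + 2 * M) * ((K * x) * (K * x)) / (e * q / 2) ^+ 2); last first.
      by rewrite /C1; field; rewrite !gt_eqF.
    by rewrite ler_wpM2r ?invr_ge0 ?sqr_ge0// -mulrA ler_wpM2l.
  rewrite (_ : C2 * _ = (2 + 2 * M) * (6 * m * (1 + m) * y) / (e * q / 2)); last first.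
    by rewrite /C2; field; rewrite !gt_eqF.
  by rewrite ler_wpM2r ?invr_ge0 ?ler_wpM2l//; lra.
- exact: cvg_cst.
- rewrite -[Y in _ --> Y](addr0 0) -[Y in _ --> Y + _](mulr0 C1) -[Y in _ --> _ + Y](mulr0 C2).
  apply: cvgD; (apply: cvgM; first exact: cvg_cst); apply: rate; rewrite /b; lra.
Qed.

End normalized_products.

End volatility_model.

(** * The spectral norm *)

Section spectral_norm.
Context (R : realType) (p : nat).
Hypothesis p_gt0 : (0 < p)%N.
Implicit Types (M : 'M[R]_p) (v : 'I_p -> R).

Definition sqnorm_mul M v : R := \sum_(i < p) (\sum_(j < p) M i j * v j) ^+ 2.

Let unit_values M := [set Num.sqrt (\sum_(i < p) ((M *m v) i ord0) ^+ 2) |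
  v in [set v : 'cV[R]_p | \sum_(i < p) (v i ord0) ^+ 2 = 1]].

Lemma sqnorm_mulE M (v : 'cV[R]_p) :
  \sum_(i < p) ((M *m v) i ord0) ^+ 2 = sqnorm_mul M (fun j => v j ord0).
Proof. by apply: eq_bigr => i _; rewrite mxE. Qed.

(** Needed for [sup] to be a genuine least upper bound; a unit vector exists because p > 0. *)
Lemma unit_values_nonempty M : unit_values M !=set0.
Proof.
pose i0 : 'I_p := Ordinal p_gt0; pose v : 'cV[R]_p := delta_mx i0 ord0.
exists (Num.sqrt (\sum_(i < p) ((M *m v) i ord0) ^+ 2)); exists v => //=.
rewrite (bigD1 i0)//= big1 ?addr0 ?mxE ?eqxx ?expr1n// => i /negbTE ii.
by rewrite mxE ii expr0n.
Qed.

Lemma sqrt_sum_sqr_le (I : finType) (f : I -> R) :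
  Num.sqrt (\sum_i f i ^+ 2) <= \sum_i `|f i|.
Proof.
have s0 : 0 <= \sum_i `|f i| by apply: sumr_ge0.
rewrite -[leRHS](ger0_norm s0) -sqrtr_sqr ler_sqrt ?sqr_ge0//.
rewrite expr2 big_distrl/=; apply: ler_sum => i _.
rewrite -(real_normK (num_real (f i))) expr2 ler_wpM2l//.
by rewrite (bigD1 i)//= lerDl sumr_ge0.
Qed.

Lemma unit_values_bound M : ubound (unit_values M) (\sum_(i < p) \sum_(j < p) `|M i j|).
Proof.
move=> _ [v /= v1 <-]; apply: le_trans (sqrt_sum_sqr_le _ _) _.
apply: ler_sum => i _; rewrite mxE; apply: le_trans (ler_norm_sum _ _ _) _.
apply: ler_sum => j _; rewrite normrM ler_piMr//.
have : v j ord0 ^+ 2 <= 1.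
  by rewrite -v1 (bigD1 j)//= lerDl sumr_ge0// => k _; exact: sqr_ge0.
by rewrite -(real_normK (num_real _)) expr_le1.
Qed.

Lemma spec_norm_le_sum M : spec_norm M <= \sum_(i < p) \sum_(j < p) `|M i j|.
Proof. by apply: ge_sup; [exact: unit_values_nonempty|exact: unit_values_bound]. Qed.

Lemma spec_norm_ge0 M : 0 <= spec_norm M.
Proof.
have [x ux] := unit_values_nonempty M.
apply: (@le_trans _ _ x); first by case: ux => v _ <-; exact: sqrtr_ge0.
by apply: ub_le_sup => //; exists (\sum_(i < p) \sum_(j < p) `|M i j|); exact: unit_values_bound.
Qed.

Lemma cvg_sumr (I : Type) (s : seq I) (f : nat -> I -> R) (l : I -> R) :
  (forall i, (fun n => f n i) @ \oo --> l i) ->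
  (fun n => \sum_(i <- s) f n i) @ \oo --> \sum_(i <- s) l i.
Proof.
move=> fl; elim: s => [|i s IH].
  by rewrite big_nil; under eq_fun do rewrite big_nil; exact: cvg_cst.
by rewrite big_cons; under eq_fun do rewrite big_cons; exact: cvgD.
Qed.

(* By density of the rationals the supremum over the sphere becomes a countable one. *)
Lemma spec_norm_gtP M (y : R) : 0 < y ->
  (y < spec_norm M) <-> exists q : {ffun 'I_p -> rat},
    y ^+ 2 * (\sum_j ratr (q j) ^+ 2) < sqnorm_mul M (fun j => ratr (q j)).
Proof.
move=> y0; split=> [yM|[q hq]].
  have [_ [v /= v1 <-]] := sup_gt (unit_values_nonempty M) yM; rewrite sqnorm_mulE => yv.
  set w := fun j => v j ord0 in yv.
  (* In this homogeneous form the vector need not have norm 1, and the strict inequality survives a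
     small perturbation to rational coordinates. *)
  have hw : y ^+ 2 * (\sum_j w j ^+ 2) < sqnorm_mul M w.
    rewrite v1 mulr1; have s0 : 0 <= sqnorm_mul M w.
      by apply: sumr_ge0 => i _; exact: sqr_ge0.
    by rewrite -(sqr_sqrtr s0) ltrXn2r ?nnegrE ?sqrtr_ge0// ltW.
  have rat_approx (x : R) : exists q : nat -> rat, (fun n => ratr (q n)) @ \oo --> x.
    have near_rat (n : nat) : {r : rat | `|x - ratr r| < n.+1%:R^-1}.
      apply: cid; have [|r] := @rat_in_itvoo R (x - n.+1%:R^-1) (x + n.+1%:R^-1).
        by rewrite ltrBlDr -addrA ltrDl addr_gt0// invr_gt0.
      by rewrite in_itv/= => hr; exists r; rewrite distrC ltr_distl.
    exists (fun n => sval (near_rat n)); apply/cvgrPdist_lt => e e0.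
    near=> n; apply: lt_trans (svalP (near_rat n)) _.
    near: n; exact: near_infty_natSinv_lt (PosNum e0).
  pose Q j := sval (cid (rat_approx (w j))).
  have Qw j : (fun n => ratr (Q j n)) @ \oo --> w j := svalP (cid (rat_approx (w j))).
  have c1 : (fun n => sqnorm_mul M (fun j => ratr (Q j n)) -
      y ^+ 2 * (\sum_j ratr (Q j n) ^+ 2)) @ \oo -->
      sqnorm_mul M w - y ^+ 2 * (\sum_j w j ^+ 2).
    apply: cvgB.
      apply: cvg_sumr => i; under eq_fun do rewrite expr2; rewrite expr2.
      by apply: cvgM; apply: cvg_sumr => j; apply: cvgM => //; exact: cvg_cst.
    apply: cvgM; first exact: cvg_cst.
    apply: cvg_sumr => j; under eq_fun do rewrite expr2; rewrite expr2.
    exact: cvgM.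
  have : \forall n \near \oo, 0 < sqnorm_mul M (fun j => ratr (Q j n)) -
      y ^+ 2 * (\sum_j ratr (Q j n) ^+ 2).
    by apply: (cvgr_gt _ c1); rewrite subr_gt0.
  move=> /filter_ex [n hn]; exists [ffun j => Q j n].
  rewrite -subr_gt0; move: hn; congr (0 < _); congr (_ - _ * _).
    by apply: eq_bigr => i _; congr (_ ^+ 2); apply: eq_bigr => j _; rewrite ffunE.
  by apply: eq_bigr => j _; rewrite ffunE.
set s := \sum_j ratr (q j) ^+ 2 in hq.
have s0 : 0 <= s by apply: sumr_ge0 => j _; exact: sqr_ge0.
(* The strict inequality excludes the zero vector, so [q] can be normalized to the sphere. *)
have sp : 0 < s.
  rewrite lt_neqAle s0 andbT eq_sym; apply/eqP => sz; move: hq; rewrite sz mulr0.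
  have qz j : ratr (q j) = 0 :> R.
    apply/eqP; rewrite -sqrf_eq0; move/eqP: sz; rewrite psumr_eq0; last by move=> k _; exact: sqr_ge0.
    by move=> /allP/(_ j (mem_index_enum _)).
  rewrite /sqnorm_mul big1 ?ltxx// => i _; rewrite big1 ?expr0n// => j _.
  by rewrite qz mulr0.
pose r := Num.sqrt s; have r0 : 0 < r by rewrite sqrtr_gt0.
have rs : r ^+ 2 = s by rewrite sqr_sqrtr.
pose v : 'cV[R]_p := \col_j (ratr (q j) / r).
have vE : sqnorm_mul M (fun j => v j ord0) = sqnorm_mul M (fun j => ratr (q j)) / s.
  rewrite /sqnorm_mul big_distrl/=; apply: eq_bigr => i _; rewrite -rs -expr_div_n.
  by congr (_ ^+ 2); rewrite big_distrl/=; apply: eq_bigr => j _; rewrite mxE mulrA.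
apply: (@lt_le_trans _ _ (Num.sqrt (sqnorm_mul M (fun j => v j ord0)))).
  rewrite -[ltLHS](ger0_norm (ltW y0)) -sqrtr_sqr ltr_sqrt vE ?ltr_pdivlMr//.
  by rewrite mul0r (le_lt_trans _ hq)// mulr_ge0// sqr_ge0.
apply: ub_le_sup; first by exists (\sum_(i < p) \sum_(j < p) `|M i j|); exact: unit_values_bound.
exists v; last by rewrite sqnorm_mulE.
rewrite /=; transitivity (\sum_j ratr (q j) ^+ 2 / s); last first.
  by rewrite -big_distrl/= divff// gt_eqF.
by apply: eq_bigr => j _; rewrite mxE expr_div_n rs.
Unshelve. all: by end_near.
Qed.

(** Monotonicity of [Pr] is available for measurable events, so the event of the theorem has to be
    one. It is a union over rational vectors, enumerated by their [pickle] codes. *)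
Lemma measurable_spec_norm_gt (d : measure_display) (T : measurableType d)
    (A : T -> 'M[R]_p) (y : R) : 0 < y ->
  (forall i j, measurable_fun setT (fun w => A w i j)) ->
  measurable [set w | y < spec_norm (A w)].
Proof.
move=> y0 mA.
pose F (q : {ffun 'I_p -> rat}) := [set w |
  y ^+ 2 * (\sum_j ratr (q j) ^+ 2) < sqnorm_mul (A w) (fun j => ratr (q j))].
rewrite (_ : [set w | _] = \bigcup_n (if unpickle n is Some q then F q else set0)).
  apply: bigcupT_measurable => n; case: unpickle => [q|] //.
  apply: measurable_gt; apply: measurable_sum => i; apply: measurable_funX.
  by apply: measurable_sum => j; apply: measurable_funM.
apply/seteqP; split=> w /=.
  by move=> /(spec_norm_gtP _ _ y0) [q hq]; exists (pickle q) => //; rewrite pickleK.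
move=> [n _]; case: unpickle => [q hq|] //.
by apply/(spec_norm_gtP _ _ y0); exists q.
Qed.

End spectral_norm.

(** * Off-diagonal entries *)

Lemma Pr_bigU_le (R : realType) (d : measure_display) (T : measurableType d)
    (P : probability T R) (I : Type) (s : seq I) (A : I -> set T) :
  (forall i, measurable (A i)) ->
  Pr P (\big[setU/set0]_(i <- s) A i) <= \sum_(i <- s) Pr P (A i).
Proof.
move=> mA; elim: s => [|i s IH]; first by rewrite !big_nil /Pr measure0.
rewrite !big_cons; apply: le_trans (PrU _ _ _ P _ _ (mA i) _) _.
  exact: bigsetU_measurable.
by rewrite lerD2l.
Qed.

Lemma offdiag_spec_norm_cvg_in_prob (R : realType) (d : measure_display)
    (T : measurableType d) (P : probability T R) (p : nat)
    (X : nat -> nat -> T -> R) (a : nat -> R) :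
  (0 < p)%N -> (forall i t, measurable_fun setT (X i t)) -> a @ \oo --> +oo ->
  (forall (i j : nat) (e : R), i != j -> 0 < e ->
    (fun n => Pr P [set w | e * a n ^+ 2 < `|\sum_(t < n) X i t w * X j t w|])
      @ \oo --> (0 : R)) ->
  cvg_in_prob P
    (fun n w => (a n ^+ 2)^-1 * spec_norm (XXt p n X w - diag_part (XXt p n X w))) 0.
Proof.
move=> p0 mX acvg Xcvg e e0.
pose D n w : 'M[R]_p := XXt p n X w - diag_part (XXt p n X w).
pose S (i j n : nat) w := \sum_(t < n) X i t w * X j t w.
have mS i j n : measurable_fun setT (S i j n).
  by apply: measurable_sum => t; exact: measurable_funM.
have DE n w i j : D n w i j = if i == j then 0 else S i j n w.
  rewrite !mxE eq_sym; have [->|_] := eqVneq j i; first by rewrite mulr1n subrr.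
  by rewrite mulr0n subr0.
have mD n i j : measurable_fun setT (fun w => D n w i j).
  rewrite (_ : (fun w => _) = (fun w => if i == j then 0 else S i j n w)).
    by case: (i == j) => //; exact: measurable_cst.
  by apply/funext => w; rewrite DE.
have p0R : 0 < p%:R :> R by rewrite ltr0n.
(* If all p^2 entries are at most c a_n^2 in modulus, the spectral norm is at most e a_n^2; a union
   bound over the entries does the rest. *)
pose c : R := e / (p%:R * p%:R).
have c0 : 0 < c by rewrite divr_gt0 ?mulr_gt0.
pose A n (ij : 'I_p * 'I_p) := if ij.1 == ij.2 then set0 else
   [set w | c * a n ^+ 2 < `|S ij.1 ij.2 n w|].
have mA n ij : measurable (A n ij).
  by rewrite /A; case: ifP => // _; exact: measurable_norm_gt.
have a1 : \forall n \near \oo, 0 < a n by move/cvgryPgt : acvg; apply.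
apply: (@squeeze_cvgr _ _ _ _ (cst 0) (fun n => \sum_(ij : 'I_p * 'I_p) Pr P (A n ij))).
- move: a1; apply: filterS => n an; rewrite Pr_ge0/=.
  have a2 : 0 < a n ^+ 2 by rewrite exprn_gt0.
  apply: le_trans (Pr_bigU_le _ _ _ _ _ _ _ (mA n)).
  have setE : [set w | e < `|(a n ^+ 2)^-1 * spec_norm (D n w) - 0|] =
      [set w | e * a n ^+ 2 < spec_norm (D n w)].
    have E w : (e < `|(a n ^+ 2)^-1 * spec_norm (D n w) - 0|) =
        (e * a n ^+ 2 < spec_norm (D n w)).
      rewrite subr0 mulrC ger0_norm ?ltr_pdivlMr// divr_ge0 ?sqr_ge0//.
      exact: spec_norm_ge0.
    by apply/seteqP; split=> w /=; rewrite E.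
  rewrite setE; apply: le_Pr.
  + by apply: measurable_spec_norm_gt => //; rewrite mulr_gt0.
  + exact: bigsetU_measurable.
  move=> w /= ew; apply: contrapT => nA.
  have small i j : `|D n w i j| <= c * a n ^+ 2.
    rewrite DE; case: eqP => [_|/eqP ij]; first by rewrite normr0 mulr_ge0// ltW.
    rewrite leNgt; apply/negP => h; apply: nA.
    rewrite (bigD1 (i, j))//=; left; rewrite /A /= ifN//.
  move: ew; rewrite ltNge => /negP; apply.
  apply: le_trans (spec_norm_le_sum _ _ p0 _) _.
  apply: (@le_trans _ _ (\sum_(i < p) \sum_(j < p) (c * a n ^+ 2))).
    by apply: ler_sum => i _; apply: ler_sum => j _; exact: small.
  rewrite !sumr_const card_ord -mulr_natl -mulr_natr /c.
  by rewrite le_eqVlt; apply/orP; left; apply/eqP; field; rewrite gt_eqF.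
- exact: cvg_cst.
- rewrite [X in _ --> X](_ : 0 = \sum_(ij : 'I_p * 'I_p) (0 : R)); last by rewrite big1.
  apply: cvg_sumr => -[i j]; rewrite /A /=; have [_|ij] := eqVneq i j.
    by under eq_fun do rewrite /Pr measure0; exact: cvg_cst.
  exact: Xcvg.
Qed.

(** * Reduction of both assumptions to one volatility model *)

(** Constants generate the trivial sigma-algebra. This lets an iid field be read as a volatility
    model with constant volatility. *)
Lemma independent_families_cst (R : realType) (d : measure_display)
    (T : measurableType d) (P : probability T R) (I J : Type) (Z : I -> T -> R) (c : R) :
  independent_families P Z (fun (_ : J) (_ : T) => c).
Proof.
move=> A B _.
have trivial_sigma : sigma_algebra setT [set C : set T | C = set0 \/ C = setT].
  split=> [|C [->|->]|F hF]; [by left|by right; rewrite setD0|by left; rewrite setDT|].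
  have [[k Fk]|nF] := pselect (exists k, F k = setT).
    by right; apply/seteqP; split=> // w _; exists k => //; rewrite Fk.
  left; apply/seteqP; split=> // w [k _]; case: (hF k) => [->//|Fk].
  by exfalso; apply: nF; exists k.
have sub : [set (fun _ : T => c) @^-1` C | _ in [set: J] & C in [set C : set R | measurable C]]
    `<=` [set C : set T | C = set0 \/ C = setT].
  move=> _ [_ _ [C _ <-]]; have [Cc|Cc] := pselect (C c).
    by right; apply/seteqP; split.
  by left; apply/seteqP; split.
move=> /(smallest_sub trivial_sigma sub) [->|->].
  by rewrite setI0 measure0 mule0.
by rewrite setIT probability_setT mule1.
Qed.

(** Stationarity for a single index, with the shift that takes the origin to [k]. It spreads the
    moment bound at the origin over the whole field. *)
Lemma strictly_stationary_marginals (R : realType) (d : measure_display)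
    (T : measurableType d) (P : probability T R) (Y : nat * nat -> T -> R) :
  strictly_stationary P Y -> forall k B, measurable B ->
  P (Y (0, 0)%N @^-1` B) = P (Y k @^-1` B).
Proof.
move=> sY k B mB; have := sY k [:: (0, 0)%N] (fun=> B) (fun=> mB).
have E (F : nat * nat -> set T) : \bigcap_(l in [set` [:: (0, 0)%N]]) F l = F (0, 0)%N.
  apply/seteqP; split=> [w /(_ (0, 0)%N)|w Fw l]; first by apply; rewrite /= inE.
  by rewrite /= inE => /eqP ->.
by rewrite !E /shift2 !add0n -surjective_pairing.
Qed.

Lemma volatility_offdiag_cvg_in_prob (R : realType) (d : measure_display)
    (T : measurableType d) (P : probability T R) (p : nat)
    (Z sigma : nat * nat -> T -> R) (X : nat -> nat -> T -> R) (a : nat -> R)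
    (alpha M : R) :
  (0 < p)%N -> (forall i t w, X i t w = sigma (i, t) w * Z (i, t) w) ->
  iid P Z -> (forall k, measurable_fun setT (sigma k)) ->
  (forall k w, 0 <= sigma k w) -> independent_families P Z sigma ->
  (forall k, P.-integrable setT (EFin \o (fun w => sigma k w ^+ 4)) /\
     \int[P]_w (sigma k w ^+ 4) <= M) ->
  0 < alpha < 4 -> regularly_varying P (Z (0, 0)%N) alpha ->
  (P.-integrable setT (EFin \o Z (0, 0)%N) ->
     (\int[P]_w (Z (0, 0)%N w)%:E = 0)%E) ->
  (fun n : nat => n%:R * Pr P [set w | a n < `| X 0%N 0%N w |]) @ \oo --> (1 : R) ->
  cvg_in_prob P
    (fun n w => (a n ^+ 2)^-1 * spec_norm (XXt p n X w - diag_part (XXt p n X w))) 0.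
Proof.
move=> p0 XE [mZ [iZ dZ]] ms s0 ind s4 al rv cZ.
have -> : X = fun i t w => sigma (i, t) w * Z (i, t) w.
  by apply/funext => i; apply/funext => t; apply/funext => w; exact: XE.
move=> ha.
apply: offdiag_spec_norm_cvg_in_prob => //.
- by move=> i t; exact: measurable_funM.
- exact: (normalizer_cvgy _ _ _ P _ _ mZ ms s0 ind _ _ rv ha).
move=> i j e ij e0.
apply: (normalized_product_cvg _ _ _ P _ _ mZ iZ dZ ms s0 ind _ s4 _ _ rv ha) => //.
by move=> /cZ z0; rewrite /Rintegral z0.
Qed.

Lemma le_pow4_powR (R : realType) (x q : R) : 0 <= x -> 4 <= q ->
  x ^+ 4 <= 1 + x `^ q.
Proof.
move=> x0 q4; have [x1|x1] := leP x 1.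
  by rewrite (@le_trans _ _ 1) ?exprn_ile1// lerDl powR_ge0.
by rewrite (@le_trans _ _ (x `^ q)) ?lerDr// -powR_mulrn// ler_powR// (ltW x1).
Qed.

Theorem theorem3p6 (R : realType) (d : measure_display) (T : measurableType d)
  (P : probability T R) (p : nat) (X : nat -> nat -> T -> R) (a : nat -> R) :
  (0 < p)%N ->
  ( (* assumption (1): iid regularly varying field *)
    (iid P (fun k : nat * nat => X k.1 k.2) /\
     (exists alpha : R, 0 < alpha < 4 /\ regularly_varying P (X 0%N 0%N) alpha) /\
     (P.-integrable setT (EFin \o X 0%N 0%N) ->
        (\int[P]_w (X 0%N 0%N w)%:E = 0)%E))
  \/
    (* assumption (2): stochastic volatility model *)
    (exists Z sigma : nat -> nat -> T -> R,
      [/\ (forall i t w, X i t w = sigma i t w * Z i t w),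
          iid P (fun k : nat * nat => Z k.1 k.2),
          (forall i t, measurable_fun setT (sigma i t)) /\
            (forall i t w, 0 <= sigma i t w),
          independent_families P (fun k : nat * nat => Z k.1 k.2)
                                 (fun k : nat * nat => sigma k.1 k.2) &
          strictly_stationary P (fun k : nat * nat => sigma k.1 k.2) /\
            ergodic_field P (fun k : nat * nat => sigma k.1 k.2)] /\
      (* (i) *)
      (exists alpha : R, [/\ 0 < alpha < 4, alpha != 2 &
         regularly_varying P (Z 0%N 0%N) alpha] /\
       (* (ii) and (iii), with the same delta *)
       exists (delta : R) (alphah : nat -> R), [/\ 0 < delta,
         (forall h, 0 <= alphah h),
         strongly_mixing_rate P p sigma alphah,
         (\sum_(0 <= h <oo) ((alphah h `^ (delta / (2 + delta)))%:E) < +oo)%E &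
         exists eps : R, 0 < eps /\
           (\int[P]_w ((sigma 0%N 0%N w) `^ (2 * Num.max (2 + delta) (alpha + eps)))%:E
              < +oo)%E]) /\
      (P.-integrable setT (EFin \o Z 0%N 0%N) ->
        (\int[P]_w (Z 0%N 0%N w)%:E = 0)%E))) ->
  (fun n : nat => n%:R * Pr P [set w | a n < `| X 0%N 0%N w |]) @ \oo --> (1 : R) ->
  cvg_in_prob P
    (fun n w => (a n ^+ 2)^-1 * spec_norm (XXt p n X w - diag_part (XXt p n X w))) 0.
Proof.
move=> p0 hyp ha; case: hyp => [[iidX [[alpha [al rv]] cX]]|].
  have [mX _] := iidX.
  apply: (volatility_offdiag_cvg_in_prob R d T P p (fun k => X k.1 k.2)
    (fun _ _ => 1) X a alpha 1) => //.
  - by move=> i t w; rewrite mul1r.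
  - exact: independent_families_cst.
  - move=> _; under eq_fun do rewrite expr1n; rewrite Rintegral_cstT.
    by split; [exact: integrable_cst_fun|].
move=> [Z [sigma [[XE iidZ [ms s0] ind [st _]]]]].
move=> [[alpha [[al _ rv] [delta [alphah [d0 _ _ _ [eps [eps0 mom]]]]]]] cZ].
set q := 2 * _ in mom.
(* The exponent in (iii) is at least 2 (2 + delta), so the fourth moment of the volatility is
   finite. *)
have q4 : 4 <= q.
  have : 2 + delta <= Num.max (2 + delta) (alpha + eps)
    by rewrite le_max lexx.
  by rewrite /q; move: (Num.max _ _) => y; lra.
have mq : measurable_fun setT (fun w => sigma 0%N 0%N w `^ q).
  exact: (measurableT_comp (measurable_powR q)).
have iq : P.-integrable setT (EFin \o (fun w => sigma 0%N 0%N w `^ q)).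
  by apply: ge0_integrable_lty => // w; exact: powR_ge0.
have i4 : P.-integrable setT (EFin \o (fun w => sigma 0%N 0%N w ^+ 4)).
  apply: (integrable_dominated _ _ _ _ _ (fun w => 1 + sigma 0%N 0%N w `^ q)).
  - exact: measurable_funX.
  - by apply: integrable_addr => //; exact: integrable_cst_fun.
  - by move=> w; rewrite ger0_norm ?exprn_ge0// le_pow4_powR.
apply: (volatility_offdiag_cvg_in_prob R d T P p (fun k => Z k.1 k.2)
  (fun k => sigma k.1 k.2) X a alpha (\int[P]_w (sigma 0%N 0%N w ^+ 4))) => // k.
have even4 (x : R) : 0 <= x ^+ 4 by rewrite (exprM x 2 2) sqr_ge0.
have [i4k ->] := ge0_integrable_ident _ _ _ P (sigma 0%N 0%N) (sigma k.1 k.2)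
  (fun x => x ^+ 4) (ms _ _) (ms _ _) (strictly_stationary_marginals _ _ _ _ _ st k)
  (measurable_funX _ (@measurable_id _ _ _)) even4 i4.
by [].
Qed.
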